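(* For every $\mathrm{SU}(3)$-invariant metric affine connection $\nabla$ on $\mathbb{S}^5$ there exist $q_1,q_2,q_3\in\mathbb{C}$ and $t\in\mathbb{R}$ such that $$\begin{aligned}\nabla_XY=\ &\nabla^g_XY+(\mathrm{Re}(q_1)-1)\big(\Phi(X,Y)\,\xi+\eta(Y)\psi(X)\big)+\mathrm{Im}(q_1)(\nabla^g_X\psi)(Y)\\&+\mathrm{Re}(q_2)\big(\eta(Y)\psi(\widehat\psi(X))+\Phi(\widehat\psi(X),Y)\xi\big)+\mathrm{Im}(q_2)\big(-\eta(Y)\widehat\psi(X)+g(\widehat\psi(X),Y)\xi\big)\\&+\mathrm{Re}(q_3)\,\eta(X)\psi(\widehat\psi(Y))-\mathrm{Im}(q_3)\,\eta(X)\widehat\psi(Y)+\Big(t+\frac12\Big)\eta(X)\psi(Y)\end{aligned}$$ for all $X,Y\in\mathfrak{X}(\mathbb{S}^5)$. Moreover, such a $\nabla$ has totally skew-symmetric torsion if and only if there are $r\in\mathbb{R}$ and $q\in\mathbb{C}$ such that $$\begin{aligned}\nabla_XY=\ &\nabla^g_XY+r\big(\Phi(X,Y)\,\xi-\eta(X)\psi(Y)+\eta(Y)\psi(X)\big)\\&+\mathrm{Re}(q)\big(\eta(Y)\psi(\widehat\psi(X))-\eta(X)\psi(\widehat\psi(Y))+\Phi(\widehat\psi(X),Y)\xi\big)\\&+\mathrm{Im}(q)\big(\eta(X)\widehat\psi(Y)-\eta(Y)\widehat\psi(X)+g(\widehat\psi(X),Y)\xi\big)\end{aligned}$$ for all 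$X,Y\in\mathfrak{X}(\mathbb{S}^5)$.
   Context: $\mathrm{SU}(3)$ acts on the unit sphere $\mathbb{S}^5\subset\mathbb{C}^3$ by matrix multiplication; write $\tau_\sigma(p)=\sigma p$. For a vector field $X$, $\tau_\sigma(X)_p=(\tau_\sigma)_*(X_{\sigma^{-1}p})$. An affine connection $\nabla$ is $\mathrm{SU}(3)$-invariant if $\tau_\sigma(\nabla_XY)=\nabla_{\tau_\sigma(X)}\tau_\sigma(Y)$ for all $\sigma\in\mathrm{SU}(3)$ and all vector fields $X,Y$. $g$ is the canonical Riemannian metric of constant sectional curvature $1$ and $\nabla^g$ its Levi-Civita connection. $\nabla$ is metric if $\nabla g=0$ (its torsion need not vanish). Its torsion is $T^\nabla(X,Y)=\nabla_XY-\nabla_YX-[X,Y]$, and $\nabla$ has totally skew-symmetric torsion if $\omega_\nabla(X,Y,Z)=g(T^\nabla(X,Y),Z)$ is a $3$-form. Sasakian structure: $\xi_z=-\mathbf{i}z$; with $N$ the unit outward normal of $\mathbb{S}^5$ in $\mathbb{C}^3$, $\psi$ and $\eta$ are determined by the decomposition $\mathbf{i}X=\psi(X)+\eta(X)N$ into tangent and normal parts; $\Phi(X,Y)=g(X,\psi(Y))$. The tensor $\widehat\psi$: let $\mathbb{O}=\mathrm{Span}_{\mathbb{R}}\{1,e_1,\dots,e_7\}$ be the octonions with $e_i^2=-1$, $e_ie_j=-e_je_i$ ($i\ne j$), $e_1e_2=e_4$, and such that whenever $e_ie_j=e_k$ then $e_{i+1}e_{j+1}=e_{k+1}$ and $e_{2i}e_{2j}=e_{2k}$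 (indices modulo $7$, in $\{1,\dots,7\}$). Identify $\mathbb{C}$ with $\mathrm{Span}\{1,e_7\}$ (with $\mathbf{i}=e_7$) and $\mathbb{C}^3$ with $\mathrm{Span}\{e_1,\dots,e_6\}$ via $(z_1,z_2,z_3)\leftrightarrow z_1e_1+z_2e_2+z_3e_4$. On the unit sphere $\mathbb{S}^6\subset\mathrm{Im}(\mathbb{O})=\mathrm{Span}\{e_1,\dots,e_7\}$ let $J$ be the almost complex structure $J(X)=\mathrm{Im}(pX)$ for $X\in T_p\mathbb{S}^6$ (octonion product, $\mathrm{Im}$ the imaginary part). View $\mathbb{S}^5\subset\mathbb{C}^3$ as the hypersurface $x_7=0$ of $\mathbb{S}^6$, with unit normal field $\nu=-\partial/\partial x_7$ (i.e. $\nu=-e_7$). For $X$ tangent to $\mathbb{S}^5$, $\widehat\psi(X)$ is the tangent part in the decomposition $J(X)=\widehat\psi(X)+\eta(X)\nu$ (the coefficient of $\nu$ coincides with the $\eta$ above). *)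

(* Defs.v *)
From HB Require Import structures.
From mathcomp Require Import all_boot all_order all_algebra.
From mathcomp Require Import all_classical all_reals all_analysis.
From mathcomp Require Import complex.
Set Implicit Arguments.
Unset Strict Implicit.
Unset Printing Implicit Defensive.
Import Order.TTheory GRing.Theory Num.Theory numFieldNormedType.Exports.
Local Open Scope sesquilinear_scope.
Local Open Scope classical_set_scope.
Local Open Scope ring_scope.

(* C^3 is carried by 'M[R]_(3, 2), so that the differential calculus of       *)
(* normed R-modules applies: row k of z holds the real and the imaginary part *)
(* of the complex coordinate z_(k+1).  Vectors tangent to S^5 at p are the    *)
(* z : C3 R orthogonal to p.                                                  *)
Notation C3 R := ('M[R]_(3, 2)).

Section ComplexSpace.
Context {R : realType}.
Implicit Types (u v z : C3 R) (s : 'M[R[i]]_3).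

Definition re_ix : 'I_2 := ord0.
Definition im_ix : 'I_2 := ord_max.

Definition toC z : 'cV[R[i]]_3 := \col_k Complex (z k re_ix) (z k im_ix).
Definition ofC (w : 'cV[R[i]]_3) : C3 R :=
  \matrix_(k, j) if j == re_ix then complex.Re (w k 0) else complex.Im (w k 0).

Lemma toCK : cancel toC ofC.
Proof.
move=> z; apply/matrixP => k j; rewrite !mxE /=; case: eqP => [->//|/eqP nj].
by congr (z k _); apply/val_inj; case: j nj => -[|[|[]]].
Qed.

Lemma ofCK : cancel ofC toC.
Proof.
by move=> w; apply/matrixP => k j; rewrite !mxE /= ord1; case: (w k 0).
Qed.

Definition mulI z : C3 R := ofC ('i%C *: toC z).

Definition dot u v : R := \sum_k \sum_j u k j * v k j.

Definition isSU3 s : Prop := s \is unitarymx /\ \det s = 1.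

Definition cact s z : C3 R := ofC (s *m toC z).

Lemma dot_cact s z : isSU3 s -> dot (cact s z) (cact s z) = dot z z.
Proof.
have dotE y : (dot y y)%:C%C = ((toC y) ^t* *m toC y) 0 0.
  rewrite mxE /dot rmorph_sum /=; apply: eq_bigr => k _.
  rewrite !mxE big_ord_recl big_ord1 /=.
  have -> : lift ord0 ord0 = im_ix by apply/val_inj.
  rewrite -[ord0]/re_ix; set a := y k re_ix; set b := y k im_ix.
  by apply/eqP; rewrite eq_complex /= !mulNr opprK [b * a]mulrC subrr !eqxx.
case=> /unitarymxP us _; apply: (@complexI R); rewrite !dotE /cact ofCK.
rewrite trmx_mul map_mxM -mulmxA; congr ((_ *m _) 0 0).
by rewrite mulmxA (mulmx1C us) mul1mx.
Qed.

End ComplexSpace.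

Section Sphere.
Context {R : realType}.

Definition S5 : Type := {p : C3 R | dot p p == 1}.

(* The default value of insubd is never used when isSU3 s (lemma val_sact).   *)
Definition sact (s : 'M[R[i]]_3) (p : S5) : S5 := insubd p (cact s (val p)).

Lemma val_sact s p : isSU3 s -> val (sact s p) = cact s (val p).
Proof. by move=> us; rewrite /sact insubdK // unfold_in dot_cact ?(valP p). Qed.

(* [Cdiff k U F]: F is of class C^k on the open set U of C^3.                 *)
Fixpoint Cdiff {W : normedModType R} (k : nat) (U : set (C3 R))
    (F : C3 R -> W) : Prop :=
  match k with
  | 0 => forall x, U x -> {for x, continuous F}
  | k'.+1 => (forall x, U x -> differentiable F x) /\
             (forall v, Cdiff k' U (fun x => 'd F x v))
  end.

Definition smooth {W : normedModType R} (f : S5 -> W) : Prop :=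
  forall p : S5, exists (U : set (C3 R)) (F : C3 R -> W),
    [/\ open U, U (val p), (forall k, Cdiff k U F)
      & forall q : S5, U (val q) -> f q = F (val q)].

(* x |-> f (x / |x|); only its values near the sphere matter, p being a       *)
(* dummy value at x = 0.                                                      *)
Definition radial {W : normedModType R} (f : S5 -> W) (p : S5) (x : C3 R) : W :=
  f (insubd p ((Num.sqrt (dot x x))^-1 *: x)).

(* For v tangent at p, this is the derivative at t = 0 of f along the curve   *)
(* t |-> (p + t v) / |p + t v| of the sphere, whose velocity at p is v.       *)
Definition der {W : normedModType R} (f : S5 -> W) (p : S5) (v : C3 R) : W :=
  'D_v (radial f p) (val p).

Definition tangent (p : S5) (v : C3 R) : Prop := dot v (val p) = 0.

Definition field := S5 -> C3 R.

Definition vector_field (X : field) : Prop :=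
  (forall p, tangent p (X p)) /\ smooth X.

(* The canonical metric of S^5, induced by the Euclidean one.                 *)
Definition g (X Y : field) : S5 -> R := fun p => dot (X p) (Y p).

Definition act_fun (X : field) (f : S5 -> R) : S5 -> R :=
  fun p => der f p (X p).

(* The coordinates of [X, Y] in C^3 are [X, Y] x_i = X (Y_i) - Y (X_i).       *)
Definition bracket (X Y : field) : field :=
  fun p => der Y p (X p) - der X p (Y p).

(* A connection is a function on all fields, but only its values on vector    *)
(* fields are ever constrained or used.                                       *)
Definition connection := field -> field -> field.
Implicit Types (nabla : connection).

Definition affine_connection nabla : Prop :=
  [/\ forall X Y, vector_field X -> vector_field Y ->
        vector_field (nabla X Y),
      forall X X' Y, vector_field X -> vector_field X' -> vector_field Y ->
        forall p, nabla (fun q => X q + X' q) Y p = nabla X Y p + nabla X' Y p,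
      forall (f : S5 -> R) X Y, smooth f -> vector_field X -> vector_field Y ->
        forall p, nabla (fun q => f q *: X q) Y p = f p *: nabla X Y p,
      forall X Y Y', vector_field X -> vector_field Y -> vector_field Y' ->
        forall p, nabla X (fun q => Y q + Y' q) p = nabla X Y p + nabla X Y' p
    & forall (f : S5 -> R) X Y, smooth f -> vector_field X -> vector_field Y ->
        forall p, nabla X (fun q => f q *: Y q) p
                  = act_fun X f p *: Y p + f p *: nabla X Y p].

Definition metric nabla : Prop :=
  forall X Y Z, vector_field X -> vector_field Y -> vector_field Z ->
  forall p, act_fun X (g Y Z) p = g (nabla X Y) Z p + g Y (nabla X Z) p.

Definition torsion nabla (X Y : field) : field :=
  fun p => nabla X Y p - nabla Y X p - bracket X Y p.

Definition torsion_free nabla : Prop :=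
  forall X Y, vector_field X -> vector_field Y ->
  forall p, torsion nabla X Y p = 0.

Definition levi_civita nabla : Prop :=
  [/\ affine_connection nabla, metric nabla & torsion_free nabla].

(* 3-forms as alternating C^oo-multilinear maps on vector fields; linearity   *)
(* in the last two arguments follows from that in the first one.              *)
Definition three_form (w : field -> field -> field -> S5 -> R) : Prop :=
  [/\ forall X Y Z, vector_field X -> vector_field Y -> vector_field Z ->
        smooth (w X Y Z),
      forall X X' Y Z, vector_field X -> vector_field X' -> vector_field Y ->
        vector_field Z ->
        forall p, w (fun q => X q + X' q) Y Z p = w X Y Z p + w X' Y Z p,
      forall (f : S5 -> R) X Y Z, smooth f -> vector_field X ->
        vector_field Y -> vector_field Z ->
        forall p, w (fun q => f q *: X q) Y Z p = f p * w X Y Z p,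
      forall X Y Z, vector_field X -> vector_field Y -> vector_field Z ->
        forall p, w X Y Z p = - w Y X Z p
    & forall X Y Z, vector_field X -> vector_field Y -> vector_field Z ->
        forall p, w X Y Z p = - w X Z Y p].

Definition totally_skew_torsion nabla : Prop :=
  three_form (fun X Y Z => g (torsion nabla X Y) Z).

Definition push (s : 'M[R[i]]_3) (X : field) : field :=
  fun p => cact s (X (sact (invmx s) p)).

Definition SU3_invariant nabla : Prop :=
  forall s, isSU3 s -> forall X Y, vector_field X -> vector_field Y ->
  forall p, push s (nabla X Y) p = nabla (push s X) (push s Y) p.

Definition xi (p : S5) : C3 R := - mulI (val p).
Definition eta_form (p : S5) (v : C3 R) : R := dot (mulI v) (val p).
Definition psi (p : S5) (v : C3 R) : C3 R := mulI v - eta_form p v *: val p.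
Definition Phi (p : S5) (u v : C3 R) : R := dot u (psi p v).

Definition cov_psi nabla (X Y : field) : field :=
  fun p => nabla X (fun q => psi q (Y q)) p - psi p (nabla X Y p).

End Sphere.

Section Octonions.
Context {R : realType}.

(* Coordinate i is the coefficient of e_i, with e_0 = 1.                      *)
Definition oct := 'rV[R]_8.
Implicit Types x y : oct.

Definition oe (i : nat) : oct := \row_(j < 8) ((j : nat) == i)%:R.

(* The representative of i modulo 7 in {1, ..., 7}.                           *)
Definition mod7 (i : nat) : nat := ((i + 6) %% 7).+1.

(* e_i e_j = (-1) ^+ otable.1 *: e_(otable.2).  Starting from e_1 e_2 = e_4,  *)
(* the shifts and the doublings give e_i e_(i+d) = e_(i+3d) for d = 1, 2, 4,  *)
(* and the other products follow from anticommutativity.                      *)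
Definition otable (i j : nat) : bool * nat :=
  if i == 0%N then (false, j) else
  if j == 0%N then (false, i) else
  if i == j then (true, 0%N) else
  let d := ((j + 7 - i) %% 7)%N in
  if d \in [:: 1; 2; 4]%N then (false, mod7 (i + 3 * d))
  else (true, mod7 (j + 3 * (7 - d))).

Definition omul x y : oct :=
  \sum_(i < 8) \sum_(j < 8)
    (x 0 i * y 0 j) *: ((-1) ^+ (otable i j).1 *: oe (otable i j).2).

Lemma omul_oe i j : (i < 8)%N -> (j < 8)%N ->
  omul (oe i) (oe j) = (-1) ^+ (otable i j).1 *: oe (otable i j).2.
Proof.
move=> li lj; rewrite /omul (bigD1 (Ordinal li)) //= (bigD1 (Ordinal lj)) //=.
rewrite !mxE !eqxx mulr1 scale1r !big1 ?addr0 // => k.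
  by move=> nk; apply: big1 => l _; rewrite !mxE (_ : _ == i = false) ?mul0r
    ?scale0r //; apply/negbTE.
move=> nk; rewrite !mxE (_ : _ == j = false) ?mulr0 ?scale0r //.
exact/negbTE.
Qed.

Lemma omul_linearl y : linear (omul^~ y).
Proof.
move=> a x x'; rewrite /omul scaler_sumr -big_split /=; apply: eq_bigr => i _.
rewrite scaler_sumr -big_split /=; apply: eq_bigr => j _.
by rewrite !mxE mulrDl scalerDl !scalerA mulrA.
Qed.

Lemma omul_linearr x : linear (omul x).
Proof.
move=> a y y'; rewrite /omul scaler_sumr -big_split /=; apply: eq_bigr => i _.
rewrite scaler_sumr -big_split /=; apply: eq_bigr => j _.
by rewrite !mxE mulrDr scalerDl !scalerA mulrCA mulrA.
Qed.

Let ix i := (0 < i < 8)%N.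

Lemma ixP i : ix i -> i \in [:: 1; 2; 3; 4; 5; 6; 7]%N.
Proof. by case: i => [|[|[|[|[|[|[|[|]]]]]]]]. Qed.

Lemma omul1 i : (i < 8)%N -> omul (oe 0) (oe i) = oe i.
Proof. by move=> li; rewrite omul_oe // expr0 scale1r. Qed.

Lemma omulr1 i : (i < 8)%N -> omul (oe i) (oe 0) = oe i.
Proof.
by move=> li; rewrite omul_oe // /otable; case: eqP => [->|_]; rewrite scale1r.
Qed.

Lemma omul_sqr i : ix i -> omul (oe i) (oe i) = - oe 0.
Proof.
move=> /andP[i0 li]; rewrite omul_oe // /otable eqn0Ngt i0 /= eqxx.
by rewrite expr1 scaleN1r.
Qed.

Lemma omul_anti i j : ix i -> ix j -> i != j ->
  omul (oe i) (oe j) = - omul (oe j) (oe i).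
Proof.
move=> hi hj nij; rewrite !omul_oe; try by case/andP: hi; case/andP: hj.
suff /eqP-> : otable i j == (~~ (otable j i).1, (otable j i).2).
  by rewrite /= signrN scaleNr.
have : all (fun a => all (fun b => (a != b) ==>
    (otable a b == (~~ (otable b a).1, (otable b a).2)))
    [:: 1; 2; 3; 4; 5; 6; 7]%N) [:: 1; 2; 3; 4; 5; 6; 7]%N by vm_compute.
by move=> /allP/(_ _ (ixP hi))/allP/(_ _ (ixP hj))/implyP/(_ nij).
Qed.

Lemma omul12 : omul (oe 1) (oe 2) = oe 4.
Proof. by rewrite omul_oe // scale1r. Qed.

Lemma omul_shift_double i j k : ix i -> ix j -> ix k ->
  omul (oe i) (oe j) = oe k ->
  omul (oe (mod7 i.+1)) (oe (mod7 j.+1)) = oe (mod7 k.+1) /\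
  omul (oe (mod7 (2 * i))) (oe (mod7 (2 * j))) = oe (mod7 (2 * k)).
Proof.
move=> hi hj hk; have mod7_lt n : (mod7 n < 8)%N by rewrite ltnS ltn_mod.
rewrite omul_oe; try by case/andP: hi; case/andP: hj.
move=> /rowP/(_ (inord k)); rewrite !mxE inordK; last by case/andP: hk.
rewrite eqxx; case: (k =P _) => [ek|_]; last first.
  by rewrite mulr0 => /eqP; rewrite eq_sym oner_eq0.
rewrite mulr1; case es: (otable i j).1.
  by rewrite expr1 /= => /eqP; rewrite eq_sym -addr_eq0 -mulr2n pnatr_eq0.
move=> _; have ot : otable i j = (false, k).
  by rewrite ek -es; case: (otable i j).
have : all (fun a => all (fun b => all (fun c =>
    (otable a b == (false, c)) ==>
    ((otable (mod7 a.+1) (mod7 b.+1) == (false, mod7 c.+1)) &&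
     (otable (mod7 (2 * a)) (mod7 (2 * b)) == (false, mod7 (2 * c)))))
    [:: 1; 2; 3; 4; 5; 6; 7]%N) [:: 1; 2; 3; 4; 5; 6; 7]%N)
    [:: 1; 2; 3; 4; 5; 6; 7]%N by vm_compute.
move=> /allP/(_ _ (ixP hi))/allP/(_ _ (ixP hj))/allP/(_ _ (ixP hk)).
rewrite ot eqxx /= => /andP[/eqP o1 /eqP o2].
by rewrite !omul_oe // o1 o2 /= !scale1r.
Qed.

Definition odot x y : R := \sum_(i < 8) x 0 i * y 0 i.

Definition oIm x : oct := x - odot x (oe 0) *: oe 0.

(* z_1 e_1 + z_2 e_2 + z_3 e_4, with C = Span {1, e_7}.                       *)
Definition c3_ix (k : 'I_3) : nat := nth 0%N [:: 1; 2; 4]%N k.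

Definition toO (z : C3 R) : oct :=
  \sum_(k < 3) omul (z k re_ix *: oe 0 + z k im_ix *: oe 7) (oe (c3_ix k)).

(* The inverse of toO on Span {e_1, ..., e_6}: the coordinates of w in the    *)
(* orthonormal basis e_1, e_7 e_1, e_2, e_7 e_2, e_4, e_7 e_4.                *)
Definition ofO (w : oct) : C3 R :=
  \matrix_(k < 3, j < 2)
    if j == re_ix then odot w (oe (c3_ix k))
    else odot w (omul (oe 7) (oe (c3_ix k))).

Lemma toOE z : toO z =
  \sum_(k < 3) (z k re_ix *: oe (c3_ix k) +
               z k im_ix *: omul (oe 7) (oe (c3_ix k))).
Proof.
apply: eq_bigr => k _; rewrite omul_linearl -[z k im_ix *: _]addr0.
have om0 y : omul 0 y = 0.
  by rewrite -[0 in LHS](subrr 0) -scaleN1r addrC omul_linearl scaleN1r addNr.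
rewrite omul_linearl om0 addr0 omul1 //.
by case: k => -[|[|[]]].
Qed.

Lemma toOK : cancel toO ofO.
Proof.
move=> z; apply/matrixP => k j; rewrite mxE toOE.
have -> : z k j = z k (if j == re_ix then re_ix else im_ix).
  case: eqP => [->//|/eqP nj]; congr (z k _); apply/val_inj.
  by case: j nj => -[|[|[]]].
rewrite /odot !omul_oe; try by case: k => -[|[|[]]].
case: k => -[|[|[|//]]] lk; case: eqP => _;
  rewrite !big_ord_recl !big_ord0 !omul_oe //= !mxE /=
    ?(mulr0, mulr1, addr0, add0r, mul0r, expr1, expr0, mulN1r, mulrN1, mul1r,
      oppr0);
  congr (z _ _); exact/val_inj.
Qed.

Definition nu : oct := - oe 7.

Definition Jcx (p v : oct) : oct := oIm (omul p v).

(* The S^5-tangent part of J v, i.e. J v minus its component along nu.        *)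
Definition hpsi (p : S5) (v : C3 R) : C3 R :=
  let w := Jcx (toO (val p)) (toO v) in ofO (w - odot w nu *: nu).

End Octonions.

(* Main.v *)
(* In terms of the derivative in C^3, the Levi-Civita connection is            *)
(* (D_X Y)_p + <X, Y> p; hence it is SU(3)-invariant, and the difference of    *)
(* nabla and nabla^g is an SU(3)-invariant tensor B, skew in the sense that    *)
(* <B(u, v), w> = - <B(u, w), v>.  SU(3) is transitive on S^5, so B is         *)
(* determined by its value at (1, 0, 0), a trilinear form on the tangent space *)
(* R + C^2 that is invariant under the stabilizer SU(2); already the           *)
(* quaternion group Q_8 in SU(2) leaves only 7 parameters, which the 7 tensors *)
(* of the theorem exhaust.  These are invariant because hat psi at p maps v to *)
(* the complex conjugate of the cross product p x v, so that                   *)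
(* <hat psi v, w> = Re det (p, v, w).  The torsion is B(X, Y) - B(Y, X), and   *)
(* it is totally skew iff <B(u, v), w> is alternating, which amounts to four   *)
(* linear relations between the parameters.                                    *)

Require Import Defs.
From HB Require Import structures.
From mathcomp Require Import all_boot all_order all_algebra.
From mathcomp Require Import all_classical all_reals all_analysis.
From mathcomp Require Import complex ring lra.
Set Implicit Arguments.
Unset Strict Implicit.
Unset Printing Implicit Defensive.
Import Order.TTheory GRing.Theory Num.Theory numFieldNormedType.Exports.
Local Open Scope classical_set_scope.
Local Open Scope ring_scope.

(** * Smooth maps on open subsets of C^3 *)

Section Calculus.
Context {R : realType}.

(** Subtracting nabla^g from nabla cancels the Leibniz terms, so the difference is a tensor B with
    <B(u, v), w> skew in v and w ([difference_tensor]). It is SU(3)-invariant because nabla^g is, as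
    its explicit formula shows ([levi_civitaE], [levi_civita_invariant]).

    SU(3) is transitive ([SU3_transitive]), so such a tensor vanishes on tangent vectors everywhere
    if it does so at (1, 0, 0). There two elements of the stabilizer force all 125 coordinates to
    vanish once seven of them do ([quaternion_invariant_eq0], [invariant_tensor_eq0]). The tensors
    of the theorem span an invariant family [invform], whose seven parameters are, up to sign,
    exactly these coordinates ([invform_base]); subtracting the right member of the family gives
    [invariant_tensorE]. The family is invariant because hat psi comes from a complex determinant
    ([dot_hpsi], [hpsi_cact]), and its b-term is nabla^g psi by [cov_psiE].

    The torsion is B(X, Y) - B(Y, X). As B is already skew in its last two arguments, a torsion
    3-form makes <B(u, v), w> alternating, which means b = 0, e = -c, f = -d, h = -a
    ([invform_totally_skew_coef]; [invform_totally_skew] for the converse). *)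

Lemma near_eq_differentiable (V W : normedModType R) (F G : V -> W) x :
  (\near x, F x = G x) -> differentiable F x -> differentiable G x.
Proof.
move=> FG dF.
have /diff_locallyP[cF eF] := dF.
have eG : G \o shift x = cst (G x) + 'd F x +o_ 0 id.
  apply/eqaddoP => e e0; rewrite -(nbhs_singleton FG).
  have /eqaddoP/(_ e e0) H := eF.
  have FG' : \forall y \near (0 : V), F (y + x) = G (y + x).
    by have := FG; rewrite (near_shift 0) /=; apply: filterS => y /=; rewrite subr0.
  by apply: filterS2 H FG' => y; rewrite !fctE /= => + <-.
apply/diff_locallyP.
by rewrite (diff_unique cF eG); split; [exact: cF|exact: eG].
Qed.

Lemma near_eq_diff (V W : normedModType R) (F G : V -> W) x v :
  (\near x, F x = G x) -> differentiable F x -> 'd G x v = 'd F x v.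
Proof.
move=> FG dF; have dG := near_eq_differentiable FG dF.
by rewrite -!deriveE //; apply/esym/near_eq_derive.
Qed.

Lemma mx_linear_continuous m n (W : normedModType R)
  (L : {linear 'M[R]_(m, n) -> W}) : continuous L.
Proof.
have -> : (L : _ -> _) = fun x => \sum_i \sum_j x i j *: L (delta_mx i j).
  apply/funext => x; rewrite {1}(matrix_sum_delta x) linear_sum.
  by apply: eq_bigr => i _; rewrite linear_sum; apply: eq_bigr => j _; rewrite linearZ.
apply: continuous_big => [|i _]; first exact: add_continuous.
apply: continuous_big => [|j _]; first exact: add_continuous.
move=> x; apply: (@continuous_comp _ _ _ (fun x : 'M[R]_(m, n) => x i j)
  (fun k : R => k *: L (delta_mx i j))).
  exact: coord_continuous.
exact: scalel_continuous.
Qed.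


Lemma near_open (T : topologicalType) (U : set T) x :
  open U -> U x -> \forall y \near x, U y.
Proof. by move=> oU Ux; apply: open_nbhs_nbhs. Qed.

Lemma Cdiff_subset (W : normedModType R) k (U V : set (C3 R)) (F : C3 R -> W) :
  V `<=` U -> Cdiff k U F -> Cdiff k V F.
Proof.
move=> VU; elim: k F => [|k IH] F /=; first by move=> h x /VU; exact: h.
by case=> h1 h2; split => [x /VU|v]; [exact: h1|exact: IH].
Qed.

Lemma Cdiff_eq (W : normedModType R) k (U : set (C3 R)) (F G : C3 R -> W) :
  open U -> (forall x, U x -> F x = G x) -> Cdiff k U F -> Cdiff k U G.
Proof.
move=> oU; elim: k F G => [|k IH] F G FG /=.
all: have nFG x : U x -> \near x, F x = G x
  by move=> Ux; have := near_open oU Ux; apply: filterS => y; exact: FG.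
  move=> h x Ux; suff : G y @[y --> x] --> G x by [].
  rewrite -(FG x Ux).
  exact: cvg_trans (near_eq_cvg (nFG x Ux)) (h x Ux).
case=> h1 h2; split => [x Ux|v].
  exact: near_eq_differentiable (nFG x Ux) (h1 x Ux).
apply: IH (h2 v) => x Ux; apply/esym.
exact: near_eq_diff (nFG x Ux) (h1 x Ux).
Qed.

Lemma Cdiff_pred (W : normedModType R) k (U : set (C3 R)) (F : C3 R -> W) :
  Cdiff k.+1 U F -> Cdiff k U F.
Proof.
elim: k F => [|k IH] F /=.
  by case=> h _ x Ux; apply: differentiable_continuous; exact: h.
by case=> h1 h2; split => // v; apply: IH; exact: h2.
Qed.

Lemma Cdiff_cst (W : normedModType R) k (U : set (C3 R)) (c : W) :
  Cdiff k U (fun=> c).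
Proof.
elim: k c => [|k IH] c /=; first by move=> x _; exact: cst_continuous.
split=> [x _|v]; first exact: differentiable_cst.
by under eq_fun do rewrite (diff_cst c); exact: IH.
Qed.

Lemma Cdiff_linear (W : normedModType R) k U (L : {linear C3 R -> W}) :
  Cdiff k U L.
Proof.
have cL : continuous L by exact: mx_linear_continuous.
case: k => [|k] /=; first by move=> x _; exact: cL.
split=> [x _|v]; first exact: linear_differentiable.
by under eq_fun do rewrite diff_lin//; exact: Cdiff_cst.
Qed.

Lemma Cdiff_comp_linear (W W' : normedModType R) k U (L : {linear W -> W'})
    (F : C3 R -> W) :
  continuous L -> open U -> Cdiff k U F -> Cdiff k U (L \o F).
Proof.
move=> cL oU; elim: k F => [|k IH] F /=.
  by move=> h x Ux; apply: continuous_comp; [exact: h|exact: cL].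
case=> h1 h2; split=> [x Ux|v].
  by apply: differentiable_comp; [exact: h1|exact: linear_differentiable].
apply: Cdiff_eq oU _ (IH _ (h2 v)) => x Ux /=.
rewrite [in RHS]diff_comp /=; first by rewrite [in RHS]diff_lin.
  exact: h1.
exact: linear_differentiable.
Qed.

(** By the chain rule, the derivative of F \o A in direction v is the derivative of F in the fixed
    direction A v, composed with A; hence the induction. It serves for the smoothness of pushed
    fields. *)
Lemma Cdiff_precomp_linear (W : normedModType R) k U
    (A : {linear C3 R -> C3 R}) (F : C3 R -> W) :
  open U -> Cdiff k U F -> Cdiff k (A @^-1` U) (F \o A).
Proof.
have cA : continuous A by exact: mx_linear_continuous.
move=> oU; have oAU : open (A @^-1` U).
  by apply: open_comp => // x _; exact: cA.
elim: k F => [|k IH] F /=.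
  by move=> h x Ux; apply: continuous_comp; [exact: cA|exact: h].
case=> h1 h2; split=> [x Ux|v].
  by apply: differentiable_comp; [exact: linear_differentiable|exact: h1].
apply: Cdiff_eq oAU _ (IH _ (h2 (A v))) => x Ux /=.
rewrite [in RHS]diff_comp /=; first by rewrite [X in _ = _ (X v)]diff_lin.
  exact: linear_differentiable.
exact: h1.
Qed.

Lemma CdiffD (W : normedModType R) k U (F G : C3 R -> W) : open U ->
  Cdiff k U F -> Cdiff k U G -> Cdiff k U (fun x => F x + G x).
Proof.
move=> oU; elim: k F G => [|k IH] F G /=.
  by move=> h h' x Ux; apply: continuousD; [exact: h|exact: h'].
case=> h1 h2 [h1' h2']; split=> [x Ux|v].
  by apply: differentiableD; [exact: h1|exact: h1'].
apply: Cdiff_eq oU _ (IH _ _ (h2 v) (h2' v)) => x Ux /=.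
by rewrite [in RHS]diffD //; [exact: h1|exact: h1'].
Qed.

(** The Leibniz rule pairs each factor with the derivative of the other, so the factors themselves
    have to be lowered to order k by [Cdiff_pred]. *)
Lemma CdiffM k U (F G : C3 R -> R) : open U ->
  Cdiff k U F -> Cdiff k U G -> Cdiff k U (fun x => F x * G x).
Proof.
move=> oU; elim: k F G => [|k IH] F G.
  by move=> h h' x Ux; apply: continuousM; [exact: h|exact: h'].
move=> hF hG; have hF' := Cdiff_pred hF; have hG' := Cdiff_pred hG.
case: hF hG => h1 h2 [h1' h2']; split=> [x Ux|v].
  by apply: differentiableM; [exact: h1|exact: h1'].
apply: Cdiff_eq oU _ (CdiffD oU (IH _ _ hF' (h2' v)) (IH _ _ hG' (h2 v))) => x Ux /=.
by rewrite [in RHS]diffM //; [exact: h1|exact: h1'].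
Qed.

Lemma Cdiff_coord k U m n (F : C3 R -> 'M[R]_(m, n)) i j : open U ->
  Cdiff k U F -> Cdiff k U (fun x => F x i j).
Proof.
move=> oU hF.
have linc : linear (fun M : 'M[R]_(m, n) => M i j : R^o) by move=> a x y; rewrite !mxE.
pose l := GRing.isLinear.Build _ _ _ _ _ linc.
pose L : {linear _ -> R^o} := HB.pack (fun M : 'M[R]_(m, n) => M i j : R^o) l.
exact: (@Cdiff_comp_linear _ _ _ _ L _ (@mx_linear_continuous _ _ _ L)).
Qed.

End Calculus.

(** * Smooth maps and vector fields on the sphere *)

Section Dot.
Context {R : realType}.
Implicit Types (u v w : C3 R) (p : @S5 R).

Lemma dotC u v : dot u v = dot v u.
Proof. by apply: eq_bigr => i _; apply: eq_bigr => j _; rewrite mulrC. Qed.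

Lemma dotDl u v w : dot (u + v) w = dot u w + dot v w.
Proof.
rewrite -big_split; apply: eq_bigr => i _; rewrite -big_split.
by apply: eq_bigr => j _; rewrite mxE mulrDl.
Qed.

Lemma dotZl (a : R) u v : dot (a *: u) v = a * dot u v.
Proof.
rewrite /dot mulr_sumr; apply: eq_bigr => i _; rewrite mulr_sumr.
by apply: eq_bigr => j _; rewrite mxE mulrA.
Qed.

Lemma dotDr u v w : dot u (v + w) = dot u v + dot u w.
Proof. by rewrite !(dotC u) dotDl. Qed.

Lemma dotZr (a : R) u v : dot u (a *: v) = a * dot u v.
Proof. by rewrite !(dotC u) dotZl. Qed.

Lemma dotNl u v : dot (- u) v = - dot u v.
Proof. by rewrite -scaleN1r dotZl mulN1r. Qed.

Lemma dotNr u v : dot u (- v) = - dot u v.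
Proof. by rewrite dotC dotNl dotC. Qed.

Lemma dotBl u v w : dot (u - v) w = dot u w - dot v w.
Proof. by rewrite dotDl dotNl. Qed.

Lemma dotBr u v w : dot u (v - w) = dot u v - dot u w.
Proof. by rewrite dotDr dotNr. Qed.

Lemma dot0l u : dot 0 u = 0.
Proof. by rewrite -(scale0r 0) dotZl mul0r. Qed.

Lemma dot_eq0 u : dot u u = 0 -> u = 0.
Proof.
move=> h; apply/matrixP => i j; rewrite mxE.
have /eqP := h; rewrite psumr_eq0; last first.
  by move=> k _; apply: sumr_ge0 => l _; rewrite -expr2 sqr_ge0.
move=> /allP/(_ i); rewrite mem_index_enum => /(_ isT) /=.
rewrite psumr_eq0; last by move=> l _; rewrite -expr2 sqr_ge0.
move=> /allP/(_ j); rewrite mem_index_enum => /(_ isT) /=.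
by rewrite mulf_eq0 orbb => /eqP.
Qed.

Lemma dot_inj u v : (forall w, dot u w = dot v w) -> u = v.
Proof.
by move=> h; apply/eqP; rewrite -subr_eq0; apply/eqP/dot_eq0; rewrite dotBl h subrr.
Qed.

Lemma dot_val p : dot (val p) (val p) = 1.
Proof. exact/eqP/(valP p). Qed.

End Dot.

Section Smooth.
Context {R : realType}.
Notation S5 := (@S5 R).

Lemma smooth_cst (W : normedModType R) (c : W) : smooth (fun _ : S5 => c).
Proof.
move=> p; exists setT, (fun=> c); split => //.
  exact: openT.
by move=> k; exact: Cdiff_cst.
Qed.

Lemma smooth_val : smooth (fun p : S5 => val p).
Proof.
move=> p; exists setT, id; split => //; first exact: openT.
by move=> k; exact: (@Cdiff_linear R _ k setT idfun).
Qed.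

Lemma smooth_linear (W W' : normedModType R) (L : {linear W -> W'}) (f : S5 -> W) :
  continuous L -> smooth f -> smooth (fun p => L (f p)).
Proof.
move=> cL sf p; have [U [F [oU Up CF fF]]] := sf p.
exists U, (L \o F); split => //; first by move=> k; exact: Cdiff_comp_linear.
by move=> q Uq; rewrite fF.
Qed.

Lemma smoothD (W : normedModType R) (f h : S5 -> W) :
  smooth f -> smooth h -> smooth (fun p => f p + h p).
Proof.
move=> sf sh p; have [U [F [oU Up CF fF]]] := sf p.
have [U' [F' [oU' Up' CF' fF']]] := sh p.
exists (U `&` U'), (fun x => F x + F' x); split => //; first exact: openI.
  move=> k; apply: CdiffD; first exact: openI.
    by apply: Cdiff_subset (CF k) => x [].
  by apply: Cdiff_subset (CF' k) => x [].
by move=> q [Uq Uq']; rewrite fF ?fF'.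
Qed.

Lemma smoothM (f h : S5 -> R) :
  smooth f -> smooth h -> smooth (fun p => f p * h p).
Proof.
move=> sf sh p; have [U [F [oU Up CF fF]]] := sf p.
have [U' [F' [oU' Up' CF' fF']]] := sh p.
exists (U `&` U'), (fun x => F x * F' x); split => //; first exact: openI.
  move=> k; apply: CdiffM; first exact: openI.
    by apply: Cdiff_subset (CF k) => x [].
  by apply: Cdiff_subset (CF' k) => x [].
by move=> q [Uq Uq']; rewrite fF ?fF'.
Qed.

Lemma smooth_sum (W : normedModType R) n (f : 'I_n -> S5 -> W) :
  (forall i, smooth (f i)) -> smooth (fun p => \sum_i f i p).
Proof.
elim: n f => [|n IH] f h.
  by under eq_fun do rewrite big_ord0; exact: smooth_cst.
under eq_fun do rewrite big_ord_recl.
by apply: smoothD => //; apply: IH => i.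
Qed.

Lemma smooth_coord m n (f : S5 -> 'M[R]_(m, n)) i j :
  smooth f -> smooth (fun p => f p i j).
Proof.
move=> sf p; have [U [F [oU Up CF fF]]] := sf p.
exists U, (fun x => F x i j); split => //; first by move=> k; exact: Cdiff_coord.
by move=> q Uq; rewrite fF.
Qed.

Lemma smoothZ_cst (W : normedModType R) (f : S5 -> R) (c : W) :
  smooth f -> smooth (fun p => f p *: c).
Proof.
have linc : linear (fun k : R^o => k *: c) by move=> a x y; rewrite scalerDl scalerA.
pose l := GRing.isLinear.Build _ _ _ _ _ linc.
pose L : {linear R^o -> _} := HB.pack (fun k : R^o => k *: c) l.
by apply: (@smooth_linear _ _ L f) => x; exact: scalel_continuous.
Qed.

Lemma smooth_mx m n (f : S5 -> 'M[R]_(m, n)) :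
  (forall i j, smooth (fun p => f p i j)) -> smooth f.
Proof.
move=> h.
rewrite (_ : f = fun x => \sum_i \sum_j f x i j *: delta_mx i j); last first.
  by apply/funext => x; exact: matrix_sum_delta.
by apply: smooth_sum => i; apply: smooth_sum => j; exact: smoothZ_cst.
Qed.

Lemma smoothZ m n (f : S5 -> R) (h : S5 -> 'M[R]_(m, n)) :
  smooth f -> smooth h -> smooth (fun p => f p *: h p).
Proof.
move=> sf sh; apply: smooth_mx => i j; under eq_fun do rewrite mxE.
by apply: smoothM => //; exact: smooth_coord.
Qed.

Lemma smoothN m n (h : S5 -> 'M[R]_(m, n)) : smooth h -> smooth (fun p => - h p).
Proof.
move=> sh; under eq_fun do rewrite -scaleN1r.
by apply: smoothZ => //; exact: smooth_cst.
Qed.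

Lemma smooth_dot (f h : S5 -> C3 R) :
  smooth f -> smooth h -> smooth (fun p => dot (f p) (h p)).
Proof.
by move=> sf sh; apply: smooth_sum => i; apply: smooth_sum => j;
  apply: smoothM; exact: smooth_coord.
Qed.

Lemma vector_fieldD (X Y : field) : vector_field X -> vector_field Y ->
  vector_field (fun p : S5 => X p + Y p).
Proof.
move=> [tX sX] [tY sY]; split; last exact: smoothD.
by move=> p; rewrite /tangent dotDl tX tY addr0.
Qed.

Lemma vector_fieldZ (f : S5 -> R) (X : field) : smooth f -> vector_field X ->
  vector_field (fun p : S5 => f p *: X p).
Proof.
move=> sf [tX sX]; split; last exact: smoothZ.
by move=> p; rewrite /tangent dotZl tX mulr0.
Qed.

Lemma vector_field0 : vector_field (fun _ : S5 => 0 : C3 R).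
Proof. by split; [move=> p; exact: dot0l|exact: smooth_cst]. Qed.

Lemma vector_field_sum n (X : 'I_n -> field) :
  (forall i, vector_field (X i)) -> vector_field (fun p : S5 => \sum_i X i p).
Proof.
elim: n X => [|n IH] X h.
  by under eq_fun do rewrite big_ord0; exact: vector_field0.
under eq_fun do rewrite big_ord_recl.
by apply: vector_fieldD => //; apply: IH => i.
Qed.

(* The tangential projections of the constant fields of C^3 span every        *)
(* tangent space, so no partition of unity is needed to localize tensors.     *)
Definition proj_field (v : C3 R) : field := fun p : S5 => v - dot v (val p) *: val p.

Lemma proj_fieldP v : vector_field (proj_field v).
Proof.
split; first by move=> p; rewrite /tangent dotBl dotZl dot_val mulr1 subrr.
apply: smoothD; first exact: smooth_cst.
apply/smoothN/smoothZ; last exact: smooth_val.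
by apply: smooth_dot; [exact: smooth_cst|exact: smooth_val].
Qed.

Lemma proj_field_tangent v (p : S5) : tangent p v -> proj_field v p = v.
Proof. by rewrite /tangent /proj_field => ->; rewrite scale0r subr0. Qed.

Lemma proj_field_linear (a : R) u v (p : S5) :
  proj_field (a *: u + v) p = a *: proj_field u p + proj_field v p.
Proof.
by rewrite /proj_field dotDl dotZl scalerDl -scalerA opprD addrACA scalerBr.
Qed.

Lemma dot_proj_field u v (p : S5) : tangent p u -> dot u (proj_field v p) = dot u v.
Proof. by rewrite dotBr dotZr => ->; rewrite mulr0 subr0. Qed.

End Smooth.

(** * Derivatives along the sphere *)

Section Derivative.
Context {R : realType}.
Notation S5 := (@S5 R).

Lemma differentiable_mx (V : normedModType R) m n (F : V -> 'M[R]_(m, n)) x :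
  (forall i j, differentiable (fun y => F y i j) x) -> differentiable F x.
Proof.
move=> h.
rewrite (_ : F = \sum_i \sum_j (fun y => F y i j *: delta_mx i j)); last first.
  apply/funext => y; rewrite {1}(matrix_sum_delta (F y)) fct_sumE.
  by apply: eq_bigr => i _; rewrite fct_sumE.
by apply: differentiable_sum => i; apply: differentiable_sum => j;
  exact: differentiableZl.
Qed.

Lemma is_derive_coord (V : normedModType R) m n (F : V -> 'M[R]_(m, n)) x v
    (dF : 'M[R]_(m, n)) i j :
  is_derive x v F dF -> is_derive x v (fun y => F y i j) (dF i j).
Proof.
case=> h <-; apply: DeriveDef; first by move/derivable_mxP : h; exact.
by rewrite derive_mx // mxE.
Qed.

Lemma is_derive_mx (V : normedModType R) m n (F : V -> 'M[R]_(m, n)) x v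
    (dF : 'M[R]_(m, n)) :
  (forall i j, is_derive x v (fun y => F y i j) (dF i j)) -> is_derive x v F dF.
Proof.
move=> h; have dvF : derivable F x v by apply/derivable_mxP => i j; case: (h i j).
apply: DeriveDef => //; rewrite derive_mx //; apply/matrixP => i j; rewrite mxE.
by case: (h i j).
Qed.

Lemma is_derive_mulr (V : normedModType R) (f h : V -> R) x v df dh :
  is_derive x v f df -> is_derive x v h dh ->
  is_derive x v (fun y => f y * h y) (df * h x + f x * dh).
Proof.
move=> hf hh; have := is_deriveM hf hh; rewrite addrC.
by rewrite [_ *: dh]/GRing.scale /= [_ *: df]mulrC.
Qed.

Lemma is_derive_scale (V : normedModType R) m n (f : V -> R) (F : V -> 'M[R]_(m, n))
    x v df dF :
  is_derive x v f df -> is_derive x v F dF ->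
  is_derive x v (fun y => f y *: F y) (df *: F x + f x *: dF).
Proof.
move=> hf hF; apply: is_derive_mx => i j; under eq_fun do rewrite mxE.
by rewrite !mxE; apply: is_derive_mulr => //; exact: is_derive_coord.
Qed.

Lemma is_derive_bigsum (V W : normedModType R) n (f : 'I_n -> V -> W) x v df :
  (forall i, is_derive x v (f i) (df i)) ->
  is_derive x v (fun y => \sum_i f i y) (\sum_i df i).
Proof.
move=> h; have := is_derive_sum h; congr is_derive.
by apply/funext => y; rewrite fct_sumE.
Qed.

Lemma is_derive_dot (V : normedModType R) (F H : V -> C3 R) x v dF dH :
  is_derive x v F dF -> is_derive x v H dH ->
  is_derive x v (fun y => dot (F y) (H y)) (dot dF (H x) + dot (F x) dH).
Proof.
move=> hF hH; rewrite /dot -big_split.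
apply: is_derive_bigsum => i /=; rewrite -big_split; apply: is_derive_bigsum => j /=.
by apply: is_derive_mulr; exact: is_derive_coord.
Qed.

Lemma is_derive_linear (V : normedModType R) m n m' n'
    (L : {linear 'M[R]_(m, n) -> 'M[R]_(m', n')}) (F : V -> 'M[R]_(m, n)) x v dF :
  is_derive x v F dF -> is_derive x v (fun y => L (F y)) (L dF).
Proof.
move=> hF.
rewrite (_ : (fun _ => _) = fun y => \sum_i \sum_j F y i j *: L (delta_mx i j));
  last first.
  apply/funext => y; rewrite {1}(matrix_sum_delta (F y)) linear_sum.
  by apply: eq_bigr => i _; rewrite linear_sum; apply: eq_bigr => j _; rewrite linearZ.
rewrite (matrix_sum_delta dF) linear_sum; apply: is_derive_bigsum => i.
rewrite linear_sum; apply: is_derive_bigsum => j; rewrite linearZ /=.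
rewrite -[X in is_derive _ _ _ X]addr0 -[X in _ + X](scaler0 _ (F x i j)).
by apply: is_derive_scale; exact: is_derive_coord.
Qed.

Definition normalize (x : C3 R) : C3 R := (Num.sqrt (dot x x))^-1 *: x.

Lemma normalize_val (p : S5) : normalize (val p) = val p.
Proof. by rewrite /normalize dot_val sqrtr1 invr1 scale1r. Qed.

Lemma differentiable_dot (x : C3 R) : differentiable (fun y => dot y y) x.
Proof.
rewrite (_ : (fun _ => _) = \sum_i \sum_j (fun y : C3 R => y i j * y i j)); last first.
  by apply/funext => y; rewrite fct_sumE; apply: eq_bigr => i _; rewrite fct_sumE.
by apply: differentiable_sum => i; apply: differentiable_sum => j;
  apply: differentiableM; exact: differentiable_coord.
Qed.

Lemma differentiable_invnorm (x : C3 R) : 0 < dot x x ->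
  differentiable (fun y => (Num.sqrt (dot y y))^-1) x.
Proof.
move=> x0; apply: differentiableV; last by rewrite gt_eqF // sqrtr_gt0.
apply: (differentiable_comp (differentiable_dot x)).

by apply/derivable1_diffP; case: (is_derive1_sqrt x0).
Qed.

Lemma differentiable_normalize (x : C3 R) : 0 < dot x x ->
  differentiable normalize x.
Proof.
move=> x0; apply: differentiable_mx => i j.
rewrite (_ : (fun _ => _) =
  (fun y => (Num.sqrt (dot y y))^-1) * (fun y : C3 R => y i j)); last first.
  by apply/funext => y; rewrite mxE.
by apply: differentiableM; [exact: differentiable_invnorm|exact: differentiable_coord].
Qed.

(** The derivative of |x|^2 at p along v is 2 <p, v> = 0: to first order, normalization does nothing
    in tangent directions. *)
Lemma is_derive_invnorm (p : S5) v : tangent p v ->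
  is_derive (val p) v (fun y => (Num.sqrt (dot y y))^-1) 0.
Proof.
move=> tv; have p0 : 0 < dot (val p) (val p) by rewrite dot_val.
have dd := differentiable_dot (val p).
have ds : differentiable (Num.sqrt : R -> R) (dot (val p) (val p)).
  by apply/derivable1_diffP; case: (is_derive1_sqrt p0).
have h : is_derive (val p) v (fun y => Num.sqrt (dot y y)) 0.
  have dsd : differentiable (fun y => Num.sqrt (dot y y)) (val p).
    exact: (differentiable_comp dd ds).
  apply: DeriveDef; first exact: diff_derivable.
  rewrite deriveE // (diff_comp dd ds) /= -(deriveE v dd).
  have := is_derive_dot (is_derive_id (val p) v) (is_derive_id (val p) v).
  by case=> _ ->; rewrite (dotC (val p)) tv addr0 linear0.
apply: DeriveDef; first by apply: diff_derivable; exact: differentiable_invnorm.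
have [hd hv] := h.
rewrite (@deriveV _ _ (fun y => Num.sqrt (dot y y))) ?hv ?scaler0 //.
by rewrite gt_eqF // sqrtr_gt0.
Qed.

(** Near p the vector x is nonzero, so its normalization lies on the sphere and the dummy value of
    [insubd] does not occur. *)
Lemma near_normalize_val (p : S5) :
  \forall x \near val p, val (insubd p (normalize x)) = normalize x.
Proof.
have cd := differentiable_continuous (differentiable_dot (val p)).
have : \forall x \near val p, 0 < dot x x.
  apply: (cd [set y | 0 < y]); apply: open_nbhs_nbhs; split; first exact: open_gt.
  by rewrite /= dot_val ltr01.
apply: filterS => x x0; rewrite insubdK // unfold_in dotZl dotZr mulrA -invfM -expr2.
by rewrite sqr_sqrtr ?ltW // mulVf // gt_eqF.
Qed.

(** A local smooth extension F of f, composed with normalization, recovers [radial f p] near p;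
    differentiability of the latter thus comes from that of F. *)
Lemma near_radial (W : normedModType R) (f : S5 -> W) p : smooth f ->
  exists F : C3 R -> W, differentiable F (val p) /\
   \forall x \near val p, F (normalize x) = radial f p x.
Proof.
move=> /(_ p)[U [F [oU Up /(_ 1%N)[dF _] fF]]]; exists F; split; first exact: dF.
have p0 : 0 < dot (val p) (val p) by rewrite dot_val.
have cn := differentiable_continuous (differentiable_normalize p0).
have : \forall x \near val p, U (normalize x).
  by apply: (cn U); apply: open_nbhs_nbhs; rewrite normalize_val.
apply: filterS2 (near_normalize_val p) => x e Ux.
by rewrite /radial fF -/(normalize x) e.
Qed.

Lemma radial_differentiable (W : normedModType R) (f : S5 -> W) p :
  smooth f -> differentiable (radial f p) (val p).
Proof.
move=> /(near_radial p)[F [dF e]]; apply: near_eq_differentiable e _.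
apply: (@differentiable_comp _ _ _ _ normalize F); last by rewrite normalize_val.
by apply: differentiable_normalize; rewrite dot_val.
Qed.

Lemma is_derive_radial (W : normedModType R) (f : S5 -> W) p v :
  smooth f -> is_derive (val p) v (radial f p) (der f p v).
Proof.
by move=> sf; apply: DeriveDef => //; apply: diff_derivable;
  exact: radial_differentiable.
Qed.

Lemma radial_self (W : normedModType R) (f : S5 -> W) p : radial f p (val p) = f p.
Proof.
rewrite /radial -/(normalize (val p)) normalize_val; congr f.
by apply: val_inj; rewrite insubdK //; exact: (valP p).
Qed.

Lemma der_val (p : S5) v : tangent p v -> der (fun q : S5 => val q) p v = v.
Proof.
move=> tv; rewrite /der.
rewrite (@near_eq_derive _ _ _ _ normalize _ v (near_normalize_val p)).
have [_ ->] := is_derive_scale (is_derive_invnorm tv) (is_derive_id (val p) v).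
by rewrite scale0r add0r dot_val sqrtr1 invr1 scale1r.
Qed.

Lemma der_dot (F H : S5 -> C3 R) p v : smooth F -> smooth H ->
  der (fun q => dot (F q) (H q)) p v = dot (der F p v) (H p) + dot (F p) (der H p v).
Proof.
move=> sF sH.
have [_] := is_derive_dot (is_derive_radial p v sF) (is_derive_radial p v sH).
by rewrite !radial_self.
Qed.

Lemma der_scale (f : S5 -> R) (F : S5 -> C3 R) p v : smooth f -> smooth F ->
  der (fun q => f q *: F q) p v = der f p v *: F p + f p *: der F p v.
Proof.
move=> sf sF.
have [_] := is_derive_scale (is_derive_radial p v sf) (is_derive_radial p v sF).
by rewrite !radial_self.
Qed.

Lemma derB (F H : S5 -> C3 R) p v : smooth F -> smooth H ->
  der (fun q => F q - H q) p v = der F p v - der H p v.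
Proof.
move=> sF sH.
by have [_] := is_deriveB (is_derive_radial p v sF) (is_derive_radial p v sH).
Qed.

Lemma der_comp_linear (L : {linear C3 R -> C3 R}) (F : S5 -> C3 R) p v : smooth F ->
  der (fun q => L (F q)) p v = L (der F p v).
Proof. by move=> sF; have [_] := is_derive_linear L (is_derive_radial p v sF). Qed.

Lemma der_cst (W : normedModType R) (c : W) (p : S5) v : der (fun _ : S5 => c) p v = 0.
Proof. exact: derive_cst. Qed.

End Derivative.

(** * Coordinates and the action of SU(3) *)

Section Coordinates.
Context {R : realType}.
Implicit Types (u v w z : C3 R) (s : 'M[R[i]]_3) (p : @S5 R).

Definition k0 : 'I_3 := @Ordinal 3 0 isT.
Definition k1 : 'I_3 := @Ordinal 3 1 isT.
Definition k2 : 'I_3 := @Ordinal 3 2 isT.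

Lemma sum3 (V : nmodType) (F : 'I_3 -> V) : \sum_i F i = F k0 + F k1 + F k2.
Proof.
rewrite !big_ord_recl big_ord0 addr0 addrA.
by congr (F _ + F _ + F _); exact: val_inj.
Qed.

Lemma sum2 (V : nmodType) (F : 'I_2 -> V) : \sum_i F i = F re_ix + F im_ix.
Proof.
rewrite !big_ord_recl big_ord0 addr0.
by congr (F _ + F _); exact: val_inj.
Qed.

Lemma ord3P (P : 'I_3 -> Prop) : P k0 -> P k1 -> P k2 -> forall k, P k.
Proof.
move=> h0 h1 h2 [[|[|[|//]]] h]; [move: h0|move: h1|move: h2];
  by congr P; exact: val_inj.
Qed.

Lemma ord2P (P : 'I_2 -> Prop) : P re_ix -> P im_ix -> forall j, P j.
Proof.
by move=> h0 h1 [[|[|//]] h]; [move: h0|move: h1]; congr P; exact: val_inj.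
Qed.

Definition zre z k : R := z k re_ix.
Definition zim z k : R := z k im_ix.

Lemma C3P u v : (forall k, zre u k = zre v k) -> (forall k, zim u k = zim v k) -> u = v.
Proof. by move=> h h'; apply/matrixP => k; apply: ord2P; [exact: h|exact: h']. Qed.

Lemma dotE u v :
  dot u v = zre u k0 * zre v k0 + zim u k0 * zim v k0
          + (zre u k1 * zre v k1 + zim u k1 * zim v k1)
          + (zre u k2 * zre v k2 + zim u k2 * zim v k2).
Proof. by rewrite /dot sum3 !sum2. Qed.

Lemma zre_ofC (c : 'cV[R[i]]_3) k : zre (ofC c) k = complex.Re (c k 0).
Proof. by rewrite /zre mxE. Qed.

Lemma zim_ofC (c : 'cV[R[i]]_3) k : zim (ofC c) k = complex.Im (c k 0).
Proof. by rewrite /zim mxE. Qed.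

Lemma toCE z k j : toC z k j = Complex (zre z k) (zim z k).
Proof. by rewrite mxE. Qed.

Lemma zreD u v k : zre (u + v) k = zre u k + zre v k. Proof. by rewrite /zre mxE. Qed.
Lemma zimD u v k : zim (u + v) k = zim u k + zim v k. Proof. by rewrite /zim mxE. Qed.
Lemma zreN u k : zre (- u) k = - zre u k. Proof. by rewrite /zre mxE. Qed.
Lemma zimN u k : zim (- u) k = - zim u k. Proof. by rewrite /zim mxE. Qed.
Lemma zreZ (a : R) u k : zre (a *: u) k = a * zre u k. Proof. by rewrite /zre mxE. Qed.
Lemma zimZ (a : R) u k : zim (a *: u) k = a * zim u k. Proof. by rewrite /zim mxE. Qed.

Lemma zre_mulI z k : zre (mulI z) k = - zim z k.
Proof. by rewrite zre_ofC mxE toCE /= mul0r mul1r sub0r. Qed.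

Lemma zim_mulI z k : zim (mulI z) k = zre z k.
Proof. by rewrite zim_ofC mxE toCE /= mul0r mul1r add0r. Qed.

(* An opaque copy of mulI: unification would otherwise unfold mulI down to    *)
(* the operations of R[i] each time two coordinates are compared.             *)
Fact iC_key : {f : C3 R -> C3 R | f = mulI}.
Proof. by exists mulI. Qed.

Definition iC : C3 R -> C3 R := sval iC_key.

Lemma mulIE : mulI = iC.
Proof. by rewrite /iC (svalP iC_key). Qed.

Lemma zre_iC z k : zre (iC z) k = - zim z k.
Proof. by rewrite -mulIE zre_mulI. Qed.

Lemma zim_iC z k : zim (iC z) k = zre z k.
Proof. by rewrite -mulIE zim_mulI. Qed.

Definition coordE := (zreD, zimD, zreN, zimN, zreZ, zimZ, zre_iC, zim_iC).

Lemma mulI_linear : linear (@mulI R).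
Proof.
by move=> a u v; rewrite mulIE; apply: C3P => k; rewrite !coordE // opprD mulrN.
Qed.

Lemma mulI_dot u v : dot (mulI u) v = - dot u (mulI v).
Proof. rewrite mulIE !dotE !coordE; ring. Qed.

Lemma toC_linear (a : R) u v : toC (a *: u + v) = (a%:C)%C *: toC u + toC v.
Proof.
apply/matrixP => k j; rewrite [LHS]toCE [RHS]mxE [in RHS]mxE !toCE !coordE.
by apply/eqP; rewrite eq_complex; apply/andP; split; apply/eqP; simpl; ring.
Qed.

Lemma cact_linear s : linear (cact s).
Proof.
move=> a u v; rewrite /cact toC_linear mulmxDr -scalemxAr.
apply: C3P => k; [rewrite zreD zreZ !zre_ofC|rewrite zimD zimZ !zim_ofC].
all: rewrite [in LHS]mxE [in LHS]mxE.
all: move: ((s *m toC u) k 0) ((s *m toC v) k 0) => [x y] [x1 y1] /=; ring.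
Qed.

Lemma cact_mulI s z : cact s (mulI z) = mulI (cact s z).
Proof. by rewrite /cact /mulI !ofCK -scalemxAr. Qed.

Lemma cactM s t z : cact s (cact t z) = cact (s *m t) z.
Proof. by rewrite /cact ofCK mulmxA. Qed.

Lemma cact1 z : cact 1%:M z = z.
Proof. by rewrite /cact mul1mx toCK. Qed.

Lemma cact_dot s u v : isSU3 s -> dot (cact s u) (cact s v) = dot u v.
Proof.
move=> us; have := dot_cact (u + v) us.
have -> : cact s (u + v) = cact s u + cact s v.
  by have := cact_linear s 1 u v; rewrite !scale1r.
move: (dot_cact u us) (dot_cact v us); move: (cact s u) (cact s v) => x y hx hy.
rewrite !dotDl !dotDr hx hy (dotC v u) (dotC y x); lra.
Qed.

Lemma isSU3_inv s : isSU3 s -> isSU3 (invmx s).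
Proof.
case=> us ds; split; last by rewrite det_inv ds invr1.
by rewrite (invmx_unitary us) trmxC_unitary.
Qed.

Lemma cactK s z : isSU3 s -> cact (invmx s) (cact s z) = z.
Proof. by case=> us _; rewrite cactM mulVmx ?cact1 // unitarymx_unit. Qed.

Lemma cactKV s z : isSU3 s -> cact s (cact (invmx s) z) = z.
Proof. by case=> us _; rewrite cactM mulmxV ?cact1 // unitarymx_unit. Qed.

Lemma sactK s p : isSU3 s -> sact (invmx s) (sact s p) = p.
Proof. by move=> us; apply: val_inj; rewrite !val_sact ?cactK //; exact: isSU3_inv. Qed.

Lemma sactKV s p : isSU3 s -> sact s (sact (invmx s) p) = p.
Proof.
by move=> us; apply: val_inj; rewrite !val_sact ?cactKV //; exact: isSU3_inv.
Qed.

Definition mulI_lin : {linear C3 R -> C3 R} :=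
  HB.pack (@mulI R) (GRing.isLinear.Build _ _ _ _ _ mulI_linear).

Definition cact_lin s : {linear C3 R -> C3 R} :=
  HB.pack (cact s) (GRing.isLinear.Build _ _ _ _ _ (cact_linear s)).

Lemma mulID u v : mulI (u + v) = mulI u + mulI v.
Proof. exact: (linearD mulI_lin). Qed.
Lemma mulIZ (a : R) v : mulI (a *: v) = a *: mulI v.
Proof. exact: (linearZ_LR mulI_lin). Qed.
Lemma cactD s u v : cact s (u + v) = cact s u + cact s v.
Proof. exact: (linearD (cact_lin s)). Qed.
Lemma cactZ s (a : R) v : cact s (a *: v) = a *: cact s v.
Proof. exact: (linearZ_LR (cact_lin s)). Qed.
Lemma cactN s v : cact s (- v) = - cact s v.
Proof. exact: (linearN (cact_lin s)). Qed.

Definition columns u v w : 'M[R[i]]_3 :=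
  \matrix_(k, j) (nth (toC u) [:: toC u; toC v; toC w] j) k 0.

Lemma mulmx_columns s u v w :
  s *m columns u v w = columns (cact s u) (cact s v) (cact s w).
Proof.
have h z k : toC (cact s z) k 0 = \sum_l s k l * toC z l 0 by rewrite /cact ofCK mxE.
by apply/matrixP => k; apply: ord3P; rewrite [RHS]mxE h [LHS]mxE; apply: eq_bigr => l _;
  rewrite [columns _ _ _ _ _]mxE.
Qed.

End Coordinates.

(** * The octonionic tensor as a conjugate cross product *)

Section CrossProduct.
Context {R : realType}.
Implicit Types (u v w z : C3 R) (s : 'M[R[i]]_3) (p : @S5 R).

Lemma det3 (T : comNzRingType) (M : 'M[T]_3) :
  \det M = M k0 k0 * (M k1 k1 * M k2 k2 - M k1 k2 * M k2 k1)
         - M k0 k1 * (M k1 k0 * M k2 k2 - M k1 k2 * M k2 k0)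
         + M k0 k2 * (M k1 k0 * M k2 k1 - M k1 k1 * M k2 k0).
Proof.
have lE (a : 'I_3) (b : 'I_2) (c : 'I_3) :
    bump a b = c -> lift a b = c.
  by move=> e; exact: val_inj.
rewrite (expand_det_row _ k0) sum3 /cofactor.
rewrite !(expand_det_row _ re_ix) !sum2 /cofactor !det_mx11 !mxE.
rewrite !(lE k0 re_ix k1) // !(lE k0 im_ix k2) //.
rewrite !(lE k1 re_ix k0) // !(lE k1 im_ix k2) //.
rewrite !(lE k2 re_ix k0) // !(lE k2 im_ix k1) //.
have l1 : lift re_ix (0 : 'I_1) = im_ix by exact: val_inj.
have l2 : lift im_ix (0 : 'I_1) = re_ix by exact: val_inj.
rewrite !l1 !l2.
rewrite !(lE k0 re_ix k1) // !(lE k0 im_ix k2) //.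
rewrite !(lE k1 re_ix k0) // !(lE k1 im_ix k2) //.
rewrite !(lE k2 re_ix k0) // !(lE k2 im_ix k1) //=.
rewrite !(addn0, add0n, addn1) !exprS !expr0; ring.
Qed.

Lemma odot_oe (x : @oct R) (n : nat) (hn : (n < 8)%N) :
  odot x (oe n) = x 0 (Ordinal hn).
Proof.
rewrite /odot (bigD1 (Ordinal hn)) //= big1; first by rewrite mxE eqxx mulr1 addr0.
by move=> i ni; rewrite mxE (_ : _ == n = false) ?mulr0 //; apply/negbTE.
Qed.

(** The order of the list reflects e_7 e_1 = e_3, e_7 e_2 = e_6 and e_7 e_4 = e_5. *)
Lemma toO_coord z : toO z = \row_(l < 8)
   nth 0 [:: 0; zre z k0; zre z k1; zim z k0; zre z k2; zim z k2; zim z k1; 0] l.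
Proof.
rewrite toOE sum3 !omul_oe // /c3_ix /=; apply/rowP => l; rewrite !mxE.
rewrite -[z k0 re_ix]/(zre z k0) -[z k1 re_ix]/(zre z k1) -[z k2 re_ix]/(zre z k2).
rewrite -[z k0 im_ix]/(zim z k0) -[z k1 im_ix]/(zim z k1) -[z k2 im_ix]/(zim z k2).
move: (zre z k0) (zre z k1) (zre z k2) (zim z k0) (zim z k1) (zim z k2).
move=> a b c a' b' c'.
by case: l => -[|[|[|[|[|[|[|[|//]]]]]]]] hl; simpl; ring.
Qed.

Lemma omul_nth (x y : seq R) (l : 'I_8) :
  omul (\row_i nth 0 x i) (\row_i nth 0 y i) 0 l =
  \sum_(0 <= i < 8) \sum_(0 <= j < 8)
    if val l == (otable i j).2 then
      if (otable i j).1 then - (nth 0 x i * nth 0 y j) else nth 0 x i * nth 0 y j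
    else 0.
Proof.
rewrite /omul summxE big_mkord; apply: eq_bigr => i _.
rewrite summxE big_mkord; apply: eq_bigr => j _; rewrite !mxE.
case: eqP => _; last by rewrite !mulr0.
by rewrite mulr1; case: (otable i j).1; rewrite ?expr1 ?mulrN1 ?mulr1.
Qed.

(** [nu] lies along e_7, whereas [ofO] reads only the coefficients of e_1, ..., e_6. *)
Lemma ofO_coord (x : @oct R) : ofO (x - odot x nu *: nu) = ofO x.
Proof.
have h i : (i < 7)%N -> odot (x - odot x nu *: nu) (oe i) = odot x (oe i).
  move=> hi; have hi8 : (i < 8)%N by exact: ltnW.
  rewrite !(odot_oe _ hi8) !mxE /= (_ : (i == 7) = false); last first.
    by apply/negbTE; rewrite neq_ltn hi.
  by rewrite oppr0 mulr0 subr0.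
apply/matrixP => k j; rewrite mxE [in RHS]mxE; case: ifP => _.
  by rewrite h //; move: k; exact: ord3P.
move: k; apply: ord3P; rewrite omul_oe // /otable /= scale1r h //.
Qed.

Lemma oIm_coord (x : @oct R) (l : 'I_8) : val l != 0%N -> oIm x 0 l = x 0 l.
Proof. by move=> l0; rewrite !mxE (negbTE l0) mulr0 subr0. Qed.

(** With [zim_hpsi], this says that [hpsi p v] is the complex conjugate of the cross product p x v:
    here are its real parts, there its negated imaginary parts. *)
Lemma zre_hpsi p v :
  [/\ zre (hpsi p v) k0 = zre (val p) k1 * zre v k2 - zim (val p) k1 * zim v k2
        - (zre (val p) k2 * zre v k1 - zim (val p) k2 * zim v k1),
      zre (hpsi p v) k1 = zre (val p) k2 * zre v k0 - zim (val p) k2 * zim v k0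
        - (zre (val p) k0 * zre v k2 - zim (val p) k0 * zim v k2)
    & zre (hpsi p v) k2 = zre (val p) k0 * zre v k1 - zim (val p) k0 * zim v k1
        - (zre (val p) k1 * zre v k0 - zim (val p) k1 * zim v k0)].
Proof.
rewrite /hpsi ofO_coord /Jcx !toO_coord; move: (val p) => q.
split; rewrite [in LHS]/zre mxE /= odot_oe => *;
  rewrite oIm_coord // omul_nth unlock /= /zre /zim; ring.
Qed.

Lemma zim_hpsi p v :
  [/\ zim (hpsi p v) k0 = - (zre (val p) k1 * zim v k2 + zim (val p) k1 * zre v k2)
        + (zre (val p) k2 * zim v k1 + zim (val p) k2 * zre v k1),
      zim (hpsi p v) k1 = - (zre (val p) k2 * zim v k0 + zim (val p) k2 * zre v k0)
        + (zre (val p) k0 * zim v k2 + zim (val p) k0 * zre v k2)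
    & zim (hpsi p v) k2 = - (zre (val p) k0 * zim v k1 + zim (val p) k0 * zre v k1)
        + (zre (val p) k1 * zim v k0 + zim (val p) k1 * zre v k0)].
Proof.
rewrite /hpsi ofO_coord /Jcx !toO_coord; move: (val p) => q.
have e7 k : (k < 3)%N -> omul (oe 7) (oe (nth 0%N [:: 1; 2; 4]%N k)) =
    oe (nth 0%N [:: 3; 6; 5]%N k) :> oct.
  by move: k => [|[|[|//]]] _; rewrite omul_oe //= scale1r.
split; rewrite [in LHS]/zim mxE /= /c3_ix e7 // odot_oe => *;
  rewrite oIm_coord // omul_nth unlock /= /zre /zim; ring.
Qed.

(** The real inner product of a conjugate vector with w is the real part of the bilinear product,
    and (p x v) . w is the determinant. *)
Lemma dot_hpsi p v w : dot (hpsi p v) w = complex.Re (\det (columns (val p) v w)).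
Proof.
have [r0 r1 r2] := zre_hpsi p v; have [i0 i1 i2] := zim_hpsi p v.
rewrite dotE r0 r1 r2 i0 i1 i2 det3 !mxE /=; move: (val p) => q.
rewrite /zre /zim; ring.
Qed.

(** Tested against w: det (s p, s v, w) = det s * det (p, v, s^-1 w), and det s = 1. Unitarity alone
    would not suffice. *)
Lemma hpsi_cact s p v : isSU3 s -> hpsi (sact s p) (cact s v) = cact s (hpsi p v).
Proof.
move=> us; apply: dot_inj => w.
have hw : dot (cact s (hpsi p v)) w = dot (hpsi p v) (cact (invmx s) w).
  by rewrite -(cact_dot (hpsi p v) _ us) (cactKV w us).
rewrite [RHS]hw [LHS]dot_hpsi [RHS]dot_hpsi (val_sact p us).
rewrite -[in LHS](cactKV w us).
rewrite -mulmx_columns det_mulmx.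
by case: us => _ ->; rewrite mul1r.
Qed.

Lemma dot_hpsi_skew p v w : dot (hpsi p v) w = - dot (hpsi p w) v.
Proof.
move: (zre_hpsi p v) (zim_hpsi p v) (zre_hpsi p w) (zim_hpsi p w).
move: (val p) (hpsi p v) (hpsi p w) => q x y.
case=> a0 a1 a2 [b0 b1 b2] [c0 c1 c2] [d0 d1 d2].
rewrite !dotE a0 a1 a2 b0 b1 b2 c0 c1 c2 d0 d1 d2; ring.
Qed.

(** [dot_hpsi_skew] moves the argument into the inner product, where linearity is evident. *)
Lemma hpsi_linear p : linear (@hpsi R p).
Proof.
move: (dot_hpsi_skew p); move: (hpsi p) => h e a u v; apply: dot_inj => w.
by rewrite dotDl dotZl !(e _ w) dotDr dotZr opprD mulrN.
Qed.

Lemma hpsi_val p v : dot (hpsi p v) (val p) = 0.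
Proof.
move: (zre_hpsi p v) (zim_hpsi p v); move: (val p) (hpsi p v) => q x.
case=> a0 a1 a2 [b0 b1 b2]; rewrite dotE a0 a1 a2 b0 b1 b2; ring.
Qed.

Lemma hpsi_mulI_val p v : dot (hpsi p v) (mulI (val p)) = 0.
Proof.
rewrite mulIE; move: (zre_hpsi p v) (zim_hpsi p v); move: (val p) (hpsi p v) => q x.
case=> a0 a1 a2 [b0 b1 b2]; rewrite dotE !coordE a0 a1 a2 b0 b1 b2; ring.
Qed.

(** The cross product is complex linear in v; the conjugation makes it antilinear. *)
Lemma hpsi_mulI p v : hpsi p (mulI v) = - mulI (hpsi p v).
Proof.
apply: dot_inj => w; rewrite mulIE dotNl.
move: (zre_hpsi p (iC v)) (zim_hpsi p (iC v)) (zre_hpsi p v) (zim_hpsi p v).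
rewrite !zre_iC !zim_iC.
move: (val p) (hpsi p v) (hpsi p (iC v)) => q x y.
case=> a0 a1 a2 [b0 b1 b2] [c0 c1 c2] [d0 d1 d2].
rewrite !dotE !coordE a0 a1 a2 b0 b1 b2 c0 c1 c2 d0 d1 d2; ring.
Qed.

End CrossProduct.

(** * The Levi-Civita connection *)

Section LeviCivita.
Context {R : realType}.
Notation S5 := (@S5 R).
Implicit Types (nabla : @connection R) (X Y Z : @field R) (s : 'M[R[i]]_3).

Lemma cact_normalize s x : isSU3 s -> cact s (normalize x) = normalize (cact s x).
Proof. by move=> us; rewrite /normalize cactZ (cact_dot x x us). Qed.

(** A unitary map commutes with normalization, so radial extension commutes with the action. *)
Lemma radial_push s Y p : isSU3 s ->
  \forall x \near val p,
    cact s (radial Y (sact (invmx s) p) (cact (invmx s) x)) = radial (push s Y) p x.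
Proof.
move=> us; have us' := isSU3_inv us; apply: filterS (near_normalize_val p) => x e.
rewrite /radial /push -!/(normalize _) -(cact_normalize _ us'); congr (cact s (Y _)).
apply: val_inj; rewrite (val_sact _ us') e insubdK //.
by rewrite unfold_in (cact_dot _ _ us') -e (valP (insubd p _)).
Qed.

Lemma is_derive_precomp (W : normedModType R) (A : {linear C3 R -> C3 R})
    (G : C3 R -> W) x v :
  differentiable G (A x) -> is_derive x v (G \o A) ('D_(A v) G (A x)).
Proof.
move=> dG.
have cA : continuous A by exact: mx_linear_continuous.
have dA : differentiable A x by exact: linear_differentiable.
have dGA : differentiable (G \o A) x by exact: differentiable_comp.
apply: DeriveDef; first exact: diff_derivable.
by rewrite deriveE // (diff_comp dA dG) deriveE //= diff_lin.
Qed.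

Lemma der_push s Y p v : isSU3 s -> smooth Y ->
  der (push s Y) p v = cact s (der Y (sact (invmx s) p) (cact (invmx s) v)).
Proof.
move=> us sY; rewrite /der -(near_eq_derive v (radial_push Y p us)).
have us' := isSU3_inv us.
set q := sact (invmx s) p.
have eq : cact_lin (invmx s) (val p) = val q by rewrite /q (val_sact p us').
have dY : differentiable (radial Y q) (cact_lin (invmx s) (val p)).
  by rewrite eq; exact: radial_differentiable.
have := is_derive_precomp v dY; rewrite eq => h.
by case: (is_derive_linear (cact_lin s) h) => _ e; exact: e.
Qed.

Lemma smooth_push s Y : isSU3 s -> smooth Y -> smooth (push s Y).
Proof.
move=> us sY p; have us' := isSU3_inv us.
have [U [F [oU Up CF fF]]] := sY (sact (invmx s) p).
have cA : continuous (cact_lin (invmx s)) by exact: mx_linear_continuous.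
have oAU : open (cact_lin (invmx s) @^-1` U) by apply: open_comp => // x _; exact: cA.
exists (cact_lin (invmx s) @^-1` U), (cact_lin s \o (F \o cact_lin (invmx s))).
split; first exact: oAU.
- by rewrite /preimage /= -(val_sact p us').
- move=> k; apply: Cdiff_comp_linear; [exact: mx_linear_continuous|exact: oAU|].
  exact: Cdiff_precomp_linear oU (CF k).
- by move=> q Uq; rewrite /push /= fF (val_sact q us').
Qed.

Lemma vector_field_push s Y : isSU3 s -> vector_field Y -> vector_field (push s Y).
Proof.
move=> us [tY sY]; split; last exact: smooth_push.
move=> p; rewrite /tangent /push -{2}(sactKV p us) (val_sact _ us) (cact_dot _ _ us).
exact: tY.
Qed.

(** Differentiate <Y, p> = 0 along X. Hence <X, Y> p is the correction that makes the derivative of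
    Y in C^3 tangent. *)
Lemma der_tangent X Y p : vector_field X -> vector_field Y ->
  dot (der Y p (X p)) (val p) = - dot (X p) (Y p).
Proof.
move=> [tX sX] [tY sY].
have := der_dot p (X p) sY (@smooth_val R).
rewrite (der_val (tX p)) (_ : (fun q => _) = (fun=> 0)); last first.
  by apply/funext => q; exact: tY.
by rewrite der_cst => /esym/eqP; rewrite addr_eq0 (dotC (Y p)) => /eqP.
Qed.

(* The difference E with the tangential projection of the derivative in C^3   *)
(* satisfies: <E(X, Y), Z> is symmetric in X, Y and skew in Y, Z, hence zero. *)
Lemma levi_civitaE nabla : levi_civita nabla ->
  forall X Y, vector_field X -> vector_field Y -> forall p,
  nabla X Y p = der Y p (X p) + dot (X p) (Y p) *: val p.
Proof.
case=> [[vn _ _ _ _] mn tn].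
pose E X Y p := nabla X Y p - (der Y p (X p) + dot (X p) (Y p) *: val p).
have Esym X Y p : vector_field X -> vector_field Y -> E X Y p = E Y X p.
  move=> vX vY; have := tn X Y vX vY p; rewrite /torsion /bracket /E (dotC (Y p)).
  move/eqP; rewrite subr_eq0 => /eqP e.
  apply/eqP; rewrite -subr_eq0 opprB addrACA; apply/eqP.
  rewrite -[RHS](subrr (der Y p (X p) - der X p (Y p))) -{1}e.
  rewrite !opprD !opprK; move: (_ *: _).
  move: (nabla X Y p) (nabla Y X p) (der Y p _) (der X p _).
  by move=> a b c d e'; apply/matrixP => i j; rewrite !mxE; ring.
have Eskew X Y Z p : vector_field X -> vector_field Y -> vector_field Z ->
    dot (E X Y p) (Z p) = - dot (E X Z p) (Y p).
  move=> vX vY vZ; have [[_ [tY sY]] [tZ sZ]] := (vX, vY, vZ).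
  have := mn X Y Z vX vY vZ p; rewrite /act_fun /g (der_dot _ _ sY sZ) /E.
  rewrite !dotBl !dotDl !dotZl (dotC (val p)) (tZ p) (dotC (val p)) (tY p).
  rewrite (dotC (Y p)) (dotC (Y p)); lra.
have E0 X Y Z p : vector_field X -> vector_field Y -> vector_field Z ->
    dot (E X Y p) (Z p) = 0.
  move=> vX vY vZ.
  have h1 := Eskew X Y Z p vX vY vZ; have h2 := Eskew Y Z X p vY vZ vX.
  have h3 := Eskew Z X Y p vZ vX vY.
  rewrite (Esym Y X) // in h2; rewrite (Esym Z Y) // in h3; rewrite (Esym X Z) // in h1.
  lra.
move=> X Y vX vY p; apply/eqP; rewrite -subr_eq0 -/(E X Y p); apply/eqP/dot_eq0.
have tE : tangent p (E X Y p).
  rewrite /tangent /E dotBl dotDl (der_tangent p vX vY) dotZl dot_val mulr1 addNr subr0.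
  exact: (vn X Y vX vY).1.
rewrite -(dot_proj_field _ tE); apply: E0 => //; exact: proj_fieldP.
Qed.

(** The formula of [levi_civitaE] involves only the derivative in C^3, the inner product and the
    position vector, all compatible with a unitary linear map. *)
Lemma levi_civita_invariant nabla : levi_civita nabla -> SU3_invariant nabla.
Proof.
move=> hn s us X Y vX vY p; have [[tX sX] [tY sY]] := (vX, vY).
rewrite (levi_civitaE hn (vector_field_push us vX) (vector_field_push us vY)).
rewrite {1}/push (levi_civitaE hn vX vY) cactD cactZ (der_push p _ us sY).
rewrite /push (cactK (X _) us) (cact_dot _ _ us); congr (_ + _ *: _).
by rewrite -(val_sact _ us) (sactKV p us).
Qed.

End LeviCivita.

(** * The difference of the two connections *)

Section DifferenceTensor.
Context {R : realType}.
Notation S5 := (@S5 R).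
Implicit Types (nabla : @connection R) (X Y Z : @field R) (s : 'M[R[i]]_3).

Lemma mulI_val_orth (p : S5) : dot (mulI (val p)) (val p) = 0.
Proof. have := mulI_dot (val p) (val p); rewrite (dotC (val p)); lra. Qed.

Lemma psi_val_orth p (v : C3 R) : dot (psi p v) (val p) = 0.
Proof. by rewrite /psi dotBl dotZl dot_val mulr1 subrr. Qed.

Lemma smooth_mulI Y : smooth Y -> smooth (fun q => mulI (Y q)).
Proof.
move=> sY.
have cI : continuous (@mulI_lin R) by exact: mx_linear_continuous.
exact: (smooth_linear cI sY).
Qed.

Lemma vector_field_psi Y : vector_field Y -> vector_field (fun q => psi q (Y q)).
Proof.
move=> [tY sY]; split; first by move=> p; exact: psi_val_orth.
have smI := smooth_mulI sY.
apply: smoothD => //; apply/smoothN/smoothZ; last exact: smooth_val.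
by apply: smooth_dot => //; exact: smooth_val.
Qed.

(** The Sasakian identity. Multiplication by i commutes with the derivative, so those terms cancel;
    differentiating the factor p in eta(Y) p leaves - eta(Y) X, the correction <X, Y> p contributes
    <X, Y> xi, and the remaining multiples of p cancel. *)
Lemma cov_psiE nabla : levi_civita nabla ->
  forall X Y, vector_field X -> vector_field Y -> forall p,
  cov_psi nabla X Y p = dot (X p) (Y p) *: xi p - eta_form p (Y p) *: X p.
Proof.
move=> hn X Y vX vY p; have [[tX sX] [tY sY]] := (vX, vY).
have smI := smooth_mulI sY.
have seta : smooth (fun q => dot (mulI (Y q)) (val q)).
  by apply: smooth_dot => //; exact: smooth_val.
rewrite /cov_psi (levi_civitaE hn vX (vector_field_psi vY)) (levi_civitaE hn vX vY).
rewrite /psi /eta_form derB //; last by apply: smoothZ => //; exact: smooth_val.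
rewrite (der_scale _ _ seta (@smooth_val R)) (der_val (tX p)).
rewrite (der_dot _ _ smI (@smooth_val R)) (der_val (tX p)).
have -> : der (fun q => mulI (Y q)) p (X p) = mulI (der Y p (X p)).
  exact: (der_comp_linear (@mulI_lin R)).
rewrite (mulID (der Y p (X p))) (mulIZ _ (val p)) /xi.
move: (mulI_val_orth p) (tX p); rewrite /tangent.
move: (mulI (der _ _ _)) (mulI (val p)) (mulI (Y p)) => a b c hb hX.
rewrite dotBr dotZr hX mulr0 subr0 dotDl dotZl hb mulr0 addr0 (dotC (X p) c).
by apply/matrixP => i j; rewrite !mxE; ring.
Qed.

(** The fields [proj_field (delta_mx i j)], with the smooth coordinates of X in C^3 as coefficients,
    expand X globally; T then sees only the values of these coefficients at p. *)
Lemma tensorial (T : @field R -> C3 R) (p : S5) :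
  (forall X Y, vector_field X -> vector_field Y ->
     T (fun q => X q + Y q) = T X + T Y) ->
  (forall (f : S5 -> R) X, smooth f -> vector_field X ->
     T (fun q => f q *: X q) = f p *: T X) ->
  forall X, vector_field X -> T X = T (proj_field (X p)).
Proof.
move=> TD TZ.
have Tsum n (X : 'I_n -> @field R) : (forall i, vector_field (X i)) ->
    T (fun q => \sum_i X i q) = \sum_i T (X i).
  elim: n X => [|n IH] X vX.
    rewrite big_ord0 (_ : (fun _ => _) = (fun=> 0)); last first.
      by apply/funext => q; rewrite big_ord0.
    have := TZ (fun=> 0) (fun=> 0) (smooth_cst 0) (@vector_field0 R).
    by rewrite /= !scale0r.
  rewrite big_ord_recl -IH // -TD //; last exact: vector_field_sum.
  by congr T; apply/funext => q; rewrite big_ord_recl.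
have TE X : vector_field X ->
    T X = \sum_i \sum_j X p i j *: T (proj_field (delta_mx i j)).
  move=> [tX sX].
  have vXij i j : vector_field (fun q => X q i j *: proj_field (delta_mx i j) q).
    by apply: vector_fieldZ; [exact: smooth_coord|exact: proj_fieldP].
  have XE : X = fun q => \sum_i \sum_j X q i j *: proj_field (delta_mx i j) q.
    apply/funext => q; rewrite -[LHS](proj_field_tangent (tX q)).
    pose l := GRing.isLinear.Build _ _ _ _ _ (fun a u v => proj_field_linear a u v q).
    pose L : {linear C3 R -> C3 R} := HB.pack (fun v => proj_field v q) l.
    rewrite -[LHS]/(L (X q)) {1}(matrix_sum_delta (X q)) linear_sum.
    apply: eq_bigr => i _; rewrite linear_sum.
    by apply: eq_bigr => j _; rewrite linearZ.
  rewrite {1}XE Tsum; last by move=> i; exact: vector_field_sum.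
  apply: eq_bigr => i _; rewrite Tsum //; apply: eq_bigr => j _.
  by rewrite TZ; [|exact: smooth_coord|exact: proj_fieldP].
move=> X vX; rewrite (TE _ vX) (TE _ (proj_fieldP _)).
by rewrite proj_field_tangent //; exact: vX.1.
Qed.

Lemma push_proj_field s v : isSU3 s -> push s (proj_field v) = proj_field (cact s v).
Proof.
move=> us; apply/funext => p.
have e : val p = cact s (val (sact (invmx s) p)).
  by rewrite -(val_sact _ us) (sactKV p us).
by rewrite /push /proj_field [in RHS]e (cact_dot _ _ us) cactD cactN cactZ.
Qed.

(** B is defined on all of C^3 by first projecting its arguments to tangent fields, so that it is
    bilinear without tangency conditions. Skewness is the difference of the two metric conditions,
    and equivariance comes from [push_proj_field]. *)
Lemma difference_tensor nablag nabla :
  levi_civita nablag -> affine_connection nabla -> metric nabla ->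
  SU3_invariant nabla ->
  exists B : S5 -> C3 R -> C3 R -> C3 R,
  [/\ forall X Y, vector_field X -> vector_field Y ->
        forall p, nabla X Y p = nablag X Y p + B p (X p) (Y p),
      forall p, (forall v, linear (B p ^~ v)) /\ (forall u, linear (B p u)),
      forall p u v, tangent p (B p u v),
      forall p u v w, dot (B p u v) w = - dot (B p u w) v
    & forall s p u v, isSU3 s ->
        B (sact s p) (cact s u) (cact s v) = cact s (B p u v)].
Proof.
move=> hg [nv nDl nZl nDr nZr] mn invn.
have invg := levi_civita_invariant hg.
have [[gv gDl gZl gDr gZr] mg _] := hg.
pose D X Y p := nabla X Y p - nablag X Y p.
have DE X Y p : vector_field X -> vector_field Y ->
    D X Y p = D (proj_field (X p)) (proj_field (Y p)) p.
  move=> vX vY.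
  have -> : D X Y p = D (proj_field (X p)) Y p.
    apply: (@tensorial (fun X => D X Y p) p) => // [U V vU vV|f U sf vU].
      by rewrite /D nDl // gDl // opprD addrACA.
    by rewrite /D nZl // gZl // scalerBr.
  apply: (@tensorial (fun Y => D (proj_field (X p)) Y p) p) => // [U V vU vV|f U sf vU].
    by rewrite /D nDr ?gDr //; [rewrite opprD addrACA|exact: proj_fieldP..].
  rewrite /D nZr ?gZr //; try exact: proj_fieldP.
  by rewrite scalerBr opprD addrACA subrr add0r.
have tD X Y p : vector_field X -> vector_field Y -> tangent p (D X Y p).
  by move=> vX vY; rewrite /tangent /D dotBl (nv X Y vX vY).1 (gv X Y vX vY).1 subrr.
have pE a u v : proj_field (a *: u + v) =
    fun q : S5 => a *: proj_field u q + proj_field v q.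
  by apply/funext => q; exact: proj_field_linear.
exists (fun p u v => D (proj_field u) (proj_field v) p); split.
- by move=> X Y vX vY p; rewrite -DE // /D addrC subrK.
- move=> p; split=> [v|v] a x y; rewrite pE /D;
    move: (@proj_fieldP R x) (@proj_fieldP R y) (@proj_fieldP R v);
    move: (@proj_field R x) (@proj_field R y) (@proj_field R v) => X Y V vX vY vV;
    have sa := @smooth_cst R R a; have vaX := vector_fieldZ sa vX.
    rewrite (nDl _ _ _ vaX vY vV) (gDl _ _ _ vaX vY vV).
    rewrite (nZl _ _ _ sa vX vV) (gZl _ _ _ sa vX vV).
    by rewrite scalerBr opprD addrACA.
  (* In the second argument the Leibniz term disappears because the scalar is a constant
     function. *)
  rewrite (nDr _ _ _ vV vaX vY) (gDr _ _ _ vV vaX vY).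
  rewrite (nZr _ _ _ sa vV vX) (gZr _ _ _ sa vV vX).
  by rewrite /act_fun der_cst !scale0r !add0r scalerBr opprD addrACA.
- by move=> p u v; apply: tD; exact: proj_fieldP.
- move=> p u v w; have vu := @proj_fieldP R u.
  have vv := @proj_fieldP R v; have vw := @proj_fieldP R w.
  have h := mn _ _ _ vu vv vw p; rewrite (mg _ _ _ vu vv vw p) in h.
  rewrite -(dot_proj_field w (tD _ _ p vu vv)) -(dot_proj_field v (tD _ _ p vu vw)).
  move: h; rewrite /g /D (dotBl (nabla (proj_field u) (proj_field v) p)).
  rewrite (dotBl (nabla (proj_field u) (proj_field w) p)).
  rewrite (dotC (proj_field v p)) (dotC (proj_field v p)); lra.
- move=> s p u v us; rewrite -!(push_proj_field _ us) /D.
  have vu := @proj_fieldP R u; have vv := @proj_fieldP R v.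
  rewrite -(invn s us) // -(invg s us) // /push (sactK p us).
  by rewrite cactD cactN.
Qed.

End DifferenceTensor.

(** * Invariants of the stabilizer *)

Section InvariantForms.
Context {R : realType}.
Implicit Types (t : nat -> nat -> nat -> R).

(* diag(1, i, -i) and the rotation E_2 -> E_3 -> - E_2 permute, up to sign,   *)
(* the real basis i E_1, E_2, i E_2, E_3, i E_3, numbered from 1 to 5; the    *)
(* index 6 stands for the zero vector.                                        *)
Definition quatA_sign (a : nat) : R := nth 1 [:: 1; 1; 1; -1; -1; 1] a.
Definition quatA (a : nat) : nat := nth 6%N [:: 0; 1; 3; 2; 5; 4]%N a.
Definition quatB_sign (a : nat) : R := nth 1 [:: 1; 1; 1; 1; -1; -1] a.
Definition quatB (a : nat) : nat := nth 6%N [:: 0; 1; 4; 5; 2; 3]%N a.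

(* The two matrices generate the quaternion group Q_8.  On T = R + H, the     *)
(* group Q_8 has the same invariants in T (x) Lambda^2 T as the whole         *)
(* stabilizer SU(2): a space of dimension 7.                                  *)
Lemma quaternion_invariant_eq0 t :
  (forall a b c, t a b c = - t a c b) ->
  (forall a b c, t a b c =
     quatA_sign a * quatA_sign b * quatA_sign c * t (quatA a) (quatA b) (quatA c)) ->
  (forall a b c, t a b c =
     quatB_sign a * quatB_sign b * quatB_sign c * t (quatB a) (quatB b) (quatB c)) ->
  [/\ t 1%N 2%N 3%N = 0, t 1%N 2%N 4%N = 0 & t 1%N 2%N 5%N = 0] ->
  [/\ t 2%N 1%N 2%N = 0, t 2%N 1%N 3%N = 0, t 2%N 1%N 4%N = 0 & t 2%N 1%N 5%N = 0] ->
  forall a b c, (0 < a < 6)%N -> (0 < b < 6)%N -> (0 < c < 6)%N -> t a b c = 0.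
Proof.
move=> hS hA hB [z1 z2 z3] [z4 z5 z6 z7] a b c.
case: a => [|[|[|[|[|[|a]]]]]] // _; case: b => [|[|[|[|[|[|b]]]]]] // _;
  case: c => [|[|[|[|[|[|c]]]]]] // _.
(* The equations collected are skewness along the orbit of the triple under 1, A, B and BA, together
   with the relations linking its members; with the seven given zeros they form a linear system. *)
all: match goal with |- _ ?a ?b ?c = 0 =>
  have h1 := hA a b c; have h2 := hA (quatA a) (quatA b) (quatA c);
  have h3 := hB a b c; have h4 := hB (quatA a) (quatA b) (quatA c);
  have s1 := hS a b c; have s2 := hS (quatA a) (quatA b) (quatA c);
  have s3 := hS (quatB a) (quatB b) (quatB c);
  have s4 := hS (quatB (quatA a)) (quatB (quatA b)) (quatB (quatA c)) end.
all: rewrite /quatA_sign /quatA /quatB_sign /quatB /= in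
  h1 h2 h3 h4 s1 s2 s3 s4; clear hS hA hB.
all: lra.
Qed.

End InvariantForms.

(** * The base point (1, 0, 0) and two elements of its stabilizer *)

Section BasePoint.
Context {R : realType}.
Implicit Types (u v w : C3 R) (s : 'M[R[i]]_3) (p : @S5 R).

(* The real basis E_1, i E_1, E_2, i E_2, E_3, i E_3 of C^3, and 0 for n > 5. *)
Definition real_basis (n : nat) : C3 R := \matrix_(k, j) ((2 * k + j)%N == n)%:R.

Lemma zre_basis n k : zre (real_basis n) k = ((2 * k)%N == n)%:R.
Proof. by rewrite /zre mxE addn0. Qed.

Lemma zim_basis n k : zim (real_basis n) k = ((2 * k + 1)%N == n)%:R.
Proof. by rewrite /zim mxE. Qed.

Lemma basis_dot m n : (m < 6)%N -> dot (real_basis m) (real_basis n) = (m == n)%:R.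
Proof.
rewrite dotE !zre_basis !zim_basis.
by case: m => [|[|[|[|[|[|m]]]]]] // _; case: n => [|[|[|[|[|[|n]]]]]] /=; ring.
Qed.

Lemma basis_sum v : v = \sum_(0 <= n < 6) dot v (real_basis n) *: real_basis n.
Proof.
rewrite unlock /= !dotE !zre_basis !zim_basis /=.
apply: C3P; apply: ord3P; rewrite !(zreD, zimD) !(zreZ, zimZ) ?zre_basis ?zim_basis /=.
all: rewrite ?(mulr0, mulr1, addr0, add0r) //; rewrite /zre /zim mxE addr0 //.
Qed.

Lemma functional_eq0 (L : C3 R -> R) u : dot u (real_basis 0) = 0 -> linear_for *%R L ->
  (forall n, (0 < n < 6)%N -> L (real_basis n) = 0) -> L u = 0.
Proof.
move=> u0 linL L0.
pose l := GRing.isLinear.Build _ _ _ _ _ (linL : linear_for (@GRing.scale R R^o) L).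
pose LL : {linear C3 R -> R^o} := HB.pack L l.
rewrite -[L u]/(LL u) {1}(basis_sum u) linear_sum big_nat big1 // => n /andP[_ hn].
rewrite linearZ /=; case: n hn => [|n] hn; first by rewrite u0 scale0r.
by rewrite L0 // scaler0.
Qed.

Lemma base_point_subproof : dot (real_basis 0) (real_basis 0) == 1.
Proof. by rewrite basis_dot. Qed.

Definition base_point : @S5 R := exist _ (real_basis 0) base_point_subproof.

Definition matA : 'M[R[i]]_3 :=
  \matrix_(k, l)
    nth 0 (nth [::] [:: [:: 1; 0; 0]; [:: 0; 'i%C; 0]; [:: 0; 0; - 'i%C]] k) l.
Definition matB : 'M[R[i]]_3 :=
  \matrix_(k, l) nth 0 (nth [::] [:: [:: 1; 0; 0]; [:: 0; 0; -1]; [:: 0; 1; 0]] k) l.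

Local Open Scope sesquilinear_scope.

Lemma matA_SU3 : isSU3 matA.
Proof.
split; last first.
  rewrite det3 !mxE /=; apply/eqP; rewrite eq_complex /=.
  by apply/andP; split; apply/eqP; ring.
apply/unitarymxP/matrixP; apply: ord3P; apply: ord3P; rewrite !mxE sum3 !mxE /=.
all: apply/eqP; rewrite eq_complex /=; apply/andP; split; apply/eqP; ring.
Qed.

Lemma matB_SU3 : isSU3 matB.
Proof.
split; last first.
  rewrite det3 !mxE /=; apply/eqP; rewrite eq_complex /=.
  by apply/andP; split; apply/eqP; ring.
apply/unitarymxP/matrixP; apply: ord3P; apply: ord3P; rewrite !mxE sum3 !mxE /=.
all: apply/eqP; rewrite eq_complex /=; apply/andP; split; apply/eqP; ring.
Qed.

Lemma cact_coord s v k :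
  (s *m toC v) k 0 = s k k0 * Complex (zre v k0) (zim v k0)
     + s k k1 * Complex (zre v k1) (zim v k1)
     + s k k2 * Complex (zre v k2) (zim v k2).
Proof. by rewrite mxE sum3 !toCE. Qed.

Lemma matA_basis n : cact matA (real_basis n) = quatA_sign n *: real_basis (quatA n).
Proof.
apply: C3P; apply: ord3P; rewrite ?zreZ ?zimZ ?zre_ofC ?zim_ofC cact_coord;
  rewrite !zre_basis !zim_basis !mxE /=.
all: case: n => [|[|[|[|[|[|n]]]]]]; rewrite /quatA_sign /quatA /= ?nth_nil /=; ring.
Qed.

Lemma matB_basis n : cact matB (real_basis n) = quatB_sign n *: real_basis (quatB n).
Proof.
apply: C3P; apply: ord3P; rewrite ?zreZ ?zimZ ?zre_ofC ?zim_ofC cact_coord;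
  rewrite !zre_basis !zim_basis !mxE /=.
all: case: n => [|[|[|[|[|[|n]]]]]]; rewrite /quatB_sign /quatB /= ?nth_nil /=; ring.
Qed.

Lemma mulI_basis :
  [/\ mulI (real_basis 0) = real_basis 1, mulI (real_basis 2) = real_basis 3
    & mulI (real_basis 4) = real_basis 5].
Proof.
by split; apply: C3P; apply: ord3P;
  rewrite ?zre_mulI ?zim_mulI ?zre_basis ?zim_basis /= ?oppr0.
Qed.

Lemma hpsi_basis : hpsi base_point (real_basis 2) = real_basis 4.
Proof.
have [a0 a1 a2] := zre_hpsi base_point (real_basis 2).
have [b0 b1 b2] := zim_hpsi base_point (real_basis 2).
by apply: C3P; apply: ord3P; rewrite ?a0 ?a1 ?a2 ?b0 ?b1 ?b2;
  rewrite !zre_basis !zim_basis /=; ring.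
Qed.

End BasePoint.

(** * Transitivity of SU(3) on the sphere *)

Section Transitivity.
Context {R : realType}.
Implicit Types (u v w : C3 R) (s : 'M[R[i]]_3) (p : @S5 R).
Local Open Scope sesquilinear_scope.

(** Reduces unitarity of a matrix to real inner products of its columns. *)
Lemma hermitian_toC u v :
  ((toC u)^t* *m toC v) 0 0 = Complex (dot u v) (dot (mulI u) v).
Proof.
rewrite mxE sum3 !mxE dotE mulIE dotE !coordE /zre /zim /=.
by apply/eqP; rewrite eq_complex /=; apply/andP; split; apply/eqP; ring.
Qed.

(** Lagrange's identity for |p x v|^2, with |p| = 1. *)
Lemma hpsi_normsq p v : dot (hpsi p v) (hpsi p v) =
  dot v v - dot (val p) v ^+ 2 - dot (mulI (val p)) v ^+ 2.
Proof.
(* Inserting |p|^2 = 1 turns the claim into a polynomial identity valid for all coordinates. *)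
have -> : dot v v = dot (val p) (val p) * dot v v by rewrite dot_val mul1r.
rewrite mulIE.
move: (zre_hpsi p v) (zim_hpsi p v); move: (val p) (hpsi p v) => q x.
case=> a0 a1 a2 [b0 b1 b2]; rewrite !dotE !coordE a0 a1 a2 b0 b1 b2; ring.
Qed.

Lemma mulI_dot_skew u v : dot (mulI u) v = - dot (mulI v) u.
Proof. exact: etrans (mulI_dot u v) (congr1 -%R (dotC u (mulI v))). Qed.

Lemma mulI_hpsi_skew p u v : dot (mulI (hpsi p u)) v = - dot (mulI (hpsi p v)) u.
Proof.
transitivity (- dot (hpsi p u) (mulI v)); first exact: mulI_dot.
congr (- _); transitivity (- dot (hpsi p (mulI v)) u); first exact: dot_hpsi_skew.
by move: (hpsi_mulI p v); move: (hpsi p (mulI v)) => x ->; rewrite dotNl opprK.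
Qed.

Lemma mulI_dot_self u : dot (mulI u) u = 0.
Proof. have := mulI_dot_skew u u; lra. Qed.

(** Any nonzero value of [hpsi p] can be normalized. By [hpsi_normsq], E_1 has the image of squared
    norm 1 - |p_1|^2; if this is not positive, then p_2 = 0 and E_2 has a nonzero image. *)
Lemma exists_unit_orthogonal p : exists v,
  [/\ dot v v = 1, dot (val p) v = 0 & dot (mulI (val p)) v = 0].
Proof.
suff [u hu] : exists u, 0 < dot (hpsi p u) (hpsi p u).
  move: (hpsi_val p u) (hpsi_mulI_val p u); move: (hpsi p u) hu => v v0 h1 h2.
  exists ((Num.sqrt (dot v v))^-1 *: v).
  rewrite !dotZr !dotZl (dotC (val p)) h1 (dotC (mulI _)) h2 !mulr0; split => //.
  by rewrite mulrA -invfM -expr2 sqr_sqrtr ?ltW // mulVf // gt_eqF.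
have e2 := dot_val p.
have sq x : 0 <= x ^+ 2 :> R by exact: sqr_ge0.
have [h|h] := ltP (zre (val p) k0 ^+ 2 + zim (val p) k0 ^+ 2) 1.
  exists (real_basis 0); rewrite hpsi_normsq mulIE; move: h e2.
  rewrite !dotE !coordE !zre_basis !zim_basis /=; nra.
exists (real_basis 2); rewrite hpsi_normsq mulIE; move: h e2.
move: (sq (zre (val p) k0)) (sq (zim (val p) k0)).
move: (sq (zre (val p) k2)) (sq (zim (val p) k2)).
rewrite !dotE !coordE !zre_basis !zim_basis /=.
have := sq (zre (val p) k1); have := sq (zim (val p) k1); nra.
Qed.

(** Complete p by a unit vector v Hermitian orthogonal to it and by w = [hpsi p v], the conjugate of
    p x v; the matrix with columns p, v, w sends (1, 0, 0) to p. *)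
Lemma SU3_transitive p : exists2 s, isSU3 s & sact s base_point = p.
Proof.
have [v [v1 pv ipv]] := exists_unit_orthogonal p.
set w := hpsi p v; pose s := columns (val p) v w.
have w1 : dot w w = 1 by rewrite hpsi_normsq v1 pv ipv expr0n !subr0.
have skew0 (x : R) : x = - x -> x = 0 by lra.
have vw : dot v w = 0 by rewrite dotC; exact: skew0 (dot_hpsi_skew p v v).
have iwv : dot (mulI w) v = 0 by exact: skew0 (mulI_hpsi_skew p v v).
have wp : dot w (val p) = 0 by exact: hpsi_val.
have ipw : dot (mulI (val p)) w = 0 by rewrite dotC; exact: hpsi_mulI_val.
have sE k l : s k l = nth (toC (val p)) [:: toC (val p); toC v; toC w] l k 0.
  by rewrite mxE.
have ss : s^t* *m s = 1%:M.
  have h k l : (s^t* *m s) k l =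
      ((nth (toC (val p)) [:: toC (val p); toC v; toC w] k)^t* *m
       (nth (toC (val p)) [:: toC (val p); toC v; toC w] l)) 0 0.
    by rewrite !mxE; apply: eq_bigr => j _; rewrite !mxE.
  apply/matrixP; apply: ord3P; apply: ord3P; rewrite h /= hermitian_toC [RHS]mxE /=.
  - by rewrite dot_val mulI_dot_self.
  - by rewrite pv ipv.
  - by rewrite dotC wp ipw.
  - by rewrite dotC pv mulI_dot_skew ipv oppr0.
  - by rewrite v1 mulI_dot_self.
  - by rewrite vw mulI_dot_skew iwv oppr0.
  - by rewrite wp mulI_dot_skew ipw oppr0.
  - by rewrite dotC vw iwv.
  - by rewrite w1 mulI_dot_self.
have us : s \is unitarymx by apply/unitarymxP; exact: mulmx1C ss.
(* By [dot_hpsi] the real part of det s is <w, w> = 1; as |det s| = 1, the imaginary part is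
   zero. *)
have ds : \det s = 1.
  have := dot_hpsi p v w; rewrite -/w w1 -/s => re1.
  have := congr1 determinant ss; rewrite det_mulmx det_map_mx det_tr det1.
  move: (\det s) re1 => [x y] /= <-; rewrite -[_^*]/(Complex 1 (- y)).
  case=> h _; have y0 : y * y = 0.
    have h' : 1 * 1 - - y * y = 1 := h.
    by apply: (@addrI _ 1); rewrite addr0 -[RHS]h' mul1r mulNr opprK.
  by have /eqP -> : y == 0 by rewrite -[_ == _]orbb -mulf_eq0 y0.
exists s => //; apply: val_inj; rewrite (val_sact _ (conj us ds)) /=.
rewrite /cact -[RHS]toCK; congr ofC; apply/matrixP => k j; rewrite (ord1 j) cact_coord.
rewrite !zre_basis !zim_basis /= !sE /= !toCE.
by apply/eqP; rewrite eq_complex /=; apply/andP; split; apply/eqP; ring.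
Qed.

End Transitivity.

(** * Classification of the invariant tensors *)

Section Classification.
Context {R : realType}.
Implicit Types (u v w : C3 R) (s : 'M[R[i]]_3) (p : @S5 R).

(* In the notation of the theorem, a = Re q1 - 1, b = Im q1, c + i d = q2,    *)
(* e + i f = q3 and h = t + 1/2.                                              *)
Definition invform (a b c d e f h : R) p u v w : R :=
  a * (eta_form p v * dot (mulI u) w - dot (mulI u) v * eta_form p w)
  + b * (dot u v * eta_form p w - eta_form p v * dot u w)
  + c * (eta_form p v * dot (mulI (hpsi p u)) w
         - dot (mulI (hpsi p u)) v * eta_form p w)
  + d * (dot (hpsi p u) v * eta_form p w - eta_form p v * dot (hpsi p u) w)
  + e * (eta_form p u * dot (mulI (hpsi p v)) w)
  - f * (eta_form p u * dot (hpsi p v) w)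
  + h * (eta_form p u * dot (mulI v) w).

Lemma hpsiD p u v : hpsi p (u + v) = hpsi p u + hpsi p v.
Proof. by have := hpsi_linear p 1 u v; rewrite !scale1r. Qed.

Lemma hpsiZ p (k : R) v : hpsi p (k *: v) = k *: hpsi p v.
Proof.
have h0 : hpsi p 0 = 0.
  by apply: (@addrI _ (hpsi p 0)); rewrite -hpsiD !addr0.
by have := hpsi_linear p k v 0; rewrite h0 !addr0.
Qed.

Lemma etaD p u v : eta_form p (u + v) = eta_form p u + eta_form p v.
Proof. by rewrite /eta_form mulID dotDl. Qed.

Lemma etaZ p (k : R) v : eta_form p (k *: v) = k * eta_form p v.
Proof. by rewrite /eta_form mulIZ dotZl. Qed.

Lemma invform_skew a b c d e f h p u v w :
  invform a b c d e f h p u v w = - invform a b c d e f h p u w v.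
Proof.
move: (dot_hpsi_skew p) (mulI_hpsi_skew p) (@mulI_dot_skew R); rewrite /invform.
move: (eta_form p) (@mulI R) (hpsi p) => E I H hH hIH hI.
rewrite (hH w v) (hIH w v) (hI w v); ring.
Qed.

Lemma invform_linear1 a b c d e f h p v w :
  linear_for *%R (fun u => invform a b c d e f h p u v w).
Proof.
move=> k x y; rewrite /invform etaD etaZ.
move: (hpsiD p) (hpsiZ p) (@mulID R) (@mulIZ R).
move: (eta_form p) (@mulI R) (hpsi p) => E I H HD HZ ID IZ.
rewrite HD HZ !ID !IZ !dotDl !dotZl; ring.
Qed.

Lemma invform_linear3 a b c d e f h p u v :
  linear_for *%R (fun w => invform a b c d e f h p u v w).
Proof.
move=> k x y; rewrite /invform etaD etaZ.
move: (eta_form p) (@mulI R) (hpsi p) => E I H; rewrite !dotDr !dotZr; ring.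
Qed.

Lemma invform_linear2 a b c d e f h p u w :
  linear_for *%R (fun v => invform a b c d e f h p u v w).
Proof.
move=> k x y; rewrite !(invform_skew _ _ _ _ _ _ _ p u _ w).
by rewrite invform_linear3 opprD mulrN.
Qed.

Lemma eta_cact s p v : isSU3 s -> eta_form (sact s p) (cact s v) = eta_form p v.
Proof.
by move=> us; rewrite /eta_form (val_sact p us) -cact_mulI (cact_dot _ _ us).
Qed.

Lemma invform_cact a b c d e f h s p u v w : isSU3 s ->
  invform a b c d e f h (sact s p) (cact s u) (cact s v) (cact s w) =
  invform a b c d e f h p u v w.
Proof.
move=> us; have hh x := hpsi_cact p x us; have hE x := eta_cact p x us.
have hD x y := cact_dot x y us; have hI := cact_mulI s.
rewrite /invform; move: hh hE hD hI.
move: (cact s) (eta_form p) (eta_form (sact s p)) (@mulI R) (hpsi p) (hpsi (sact s p)).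
move=> S E E' I H H' hh hE hD hI.
by rewrite !hE !hh -!hI !hD.
Qed.

Lemma sact_base s : isSU3 s -> cact s (real_basis 0) = real_basis 0 ->
  sact s base_point = base_point.
Proof. by move=> us e; apply: val_inj; rewrite (val_sact _ us). Qed.

(** Each parameter is one coordinate up to sign, so the seven can be prescribed independently. At
    the base point xi = - i E_1, whence eta(i E_1) = -1; and hat psi sends E_2 to E_3. *)
Lemma invform_base a b c d e f h (F := invform a b c d e f h base_point)
   (E := @real_basis R) :
  [/\ F (E 1%N) (E 2%N) (E 3%N) = - h, F (E 1%N) (E 2%N) (E 4%N) = f
    & F (E 1%N) (E 2%N) (E 5%N) = - e] /\
  [/\ F (E 2%N) (E 1%N) (E 2%N) = b, F (E 2%N) (E 1%N) (E 3%N) = - a,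
      F (E 2%N) (E 1%N) (E 4%N) = d & F (E 2%N) (E 1%N) (E 5%N) = - c].
Proof.
have [m0 m2 m4] := @mulI_basis R.
have hE n : eta_form base_point (real_basis n) = - (1%N == n)%:R :> R.
  by rewrite /eta_form /base_point /= mulI_dot dotC m0 basis_dot.
rewrite /F /E /invform; move: m2 m4 hE (@hpsi_basis R).
move: (eta_form base_point) (@mulI R) (hpsi base_point) => eta I H m2 m4 hE h2.
rewrite !hE h2 m4 m2 !(@basis_dot R 2) // !(@basis_dot R 3) //.
rewrite !(@basis_dot R 4) // !(@basis_dot R 5) //=.
by split; split; ring.
Qed.

(** Transitivity moves the three tangent vectors to the base point. Invariance under [matA] and
    [matB], which fix that point, gives the hypotheses of [quaternion_invariant_eq0]; multilinearity
    then passes from basis vectors to all tangent vectors. *)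
Lemma invariant_tensor_eq0 (T : @S5 R -> C3 R -> C3 R -> C3 R -> R)
    (E := @real_basis R) :
  (forall p v w, linear_for *%R (fun u => T p u v w)) ->
  (forall p u w, linear_for *%R (fun v => T p u v w)) ->
  (forall p u v, linear_for *%R (T p u v)) ->
  (forall p u v w, T p u v w = - T p u w v) ->
  (forall s p u v w, isSU3 s ->
     T (sact s p) (cact s u) (cact s v) (cact s w) = T p u v w) ->
  [/\ T base_point (E 1%N) (E 2%N) (E 3%N) = 0,
      T base_point (E 1%N) (E 2%N) (E 4%N) = 0
    & T base_point (E 1%N) (E 2%N) (E 5%N) = 0] ->
  [/\ T base_point (E 2%N) (E 1%N) (E 2%N) = 0,
      T base_point (E 2%N) (E 1%N) (E 3%N) = 0,
      T base_point (E 2%N) (E 1%N) (E 4%N) = 0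
    & T base_point (E 2%N) (E 1%N) (E 5%N) = 0] ->
  forall p u v w, tangent p u -> tangent p v -> tangent p w -> T p u v w = 0.
Proof.
move=> lin1 lin2 lin3 skew equiv z1 z2 p u v w tu tv tw.
have [s us sp] := SU3_transitive p.
have su' x : cact s (cact (invmx s) x) = x by exact: cactKV.
have t0 x : tangent p x -> dot (cact (invmx s) x) (E 0%N) = 0.
  by move=> tx; rewrite -(cact_dot _ _ us) su' -tx -sp (val_sact _ us).
rewrite -sp -(su' u) -(su' v) -(su' w) (equiv _ _ _ _ _ us).
move: (t0 _ tu) (t0 _ tv) (t0 _ tw).
move: (cact _ u) (cact _ v) (cact _ w) => x y z x0 y0 z0.
have inv r a b c : isSU3 r -> cact r (E 0%N) = E 0%N ->
    T base_point (cact r a) (cact r b) (cact r c) = T base_point a b c.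
  by move=> ur er; rewrite -{1}(sact_base ur er) equiv.
have scal (L : C3 R -> R) k a : linear_for *%R L -> L (k *: a) = k * L a.
  move=> linL; have L0 : L 0 = 0.
    by have := linL (-1) 0 0; rewrite scaler0 addr0 mulN1r addNr.
  by have := linL k a 0; rewrite L0 !addr0.
have scal3 k k' k'' a b c :
    T base_point (k *: a) (k' *: b) (k'' *: c) = k * k' * k'' * T base_point a b c.
  rewrite (scal _ _ _ (lin1 base_point (k' *: b) (k'' *: c))).
  rewrite (scal _ _ _ (lin2 base_point a (k'' *: c))).
  by rewrite (scal _ _ _ (lin3 base_point a b)) !mulrA.
have vanish : forall i j k, (0 < i < 6)%N -> (0 < j < 6)%N -> (0 < k < 6)%N ->
    T base_point (E i) (E j) (E k) = 0.
  apply: (@quaternion_invariant_eq0 R (fun i j k =>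
    T base_point (E i) (E j) (E k))) => //.
  - move=> i j k; have h := inv matA (E i) (E j) (E k) (@matA_SU3 R).
    by rewrite -h ?matA_basis ?scal3 ?scale1r.
  - move=> i j k; have h := inv matB (E i) (E j) (E k) (@matB_SU3 R).
    by rewrite -h ?matB_basis ?scal3 ?scale1r.
apply: (functional_eq0 x0 (lin1 _ y z)) => i hi.
apply: (functional_eq0 y0 (lin2 _ _ z)) => j hj.
by apply: (functional_eq0 z0 (lin3 _ _ _)) => k hk; exact: vanish.
Qed.

Lemma invariant_tensorE (B : @S5 R -> C3 R -> C3 R -> C3 R) :
  (forall p, (forall v, linear (B p ^~ v)) /\ (forall u, linear (B p u))) ->
  (forall p u v w, dot (B p u v) w = - dot (B p u w) v) ->
  (forall s p u v, isSU3 s -> B (sact s p) (cact s u) (cact s v) = cact s (B p u v)) ->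
  exists a b c d e f h, forall p u v w, tangent p u -> tangent p v -> tangent p w ->
    dot (B p u v) w = invform a b c d e f h p u v w.
Proof.
move=> Blin Bskew Bequiv; pose E := @real_basis R.
pose t i j k := dot (B base_point (E i) (E j)) (E k).
(* These values invert [invform_base]: the two forms then agree at the seven coordinates that
   determine an invariant tensor. *)
pose a := - t 2%N 1%N 3%N; pose b := t 2%N 1%N 2%N; pose c := - t 2%N 1%N 5%N.
pose d := t 2%N 1%N 4%N; pose e := - t 1%N 2%N 5%N; pose f := t 1%N 2%N 4%N.
pose h := - t 1%N 2%N 3%N.
exists a, b, c, d, e, f, h => p u v w tu tv tw.
have [[f1 f2 f3] [f4 f5 f6 f7]] := invform_base a b c d e f h.
have Fskew := invform_skew a b c d e f h.
have F1 := invform_linear1 a b c d e f h.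
have F2 := invform_linear2 a b c d e f h.
have F3 := invform_linear3 a b c d e f h.
have Finv := invform_cact a b c d e f h.
move: f1 f2 f3 f4 f5 f6 f7 Fskew F1 F2 F3 Finv.
rewrite {}/a {}/b {}/c {}/d {}/e {}/f {}/h.
move: (invform _ _ _ _ _ _ _) => F f1 f2 f3 f4 f5 f6 f7 Fskew F1 F2 F3 Finv.
apply/eqP; rewrite -subr_eq0; apply/eqP.
apply: (@invariant_tensor_eq0 (fun p u v w => dot (B p u v) w - F p u v w)) => //.
- move=> q y z k x x'; rewrite (Blin q).1 dotDl dotZl.
  have /= -> := F1 q y z k x x'; ring.
- move=> q x z k y y'; rewrite (Blin q).2 dotDl dotZl.
  have /= -> := F2 q x z k y y'; ring.
- move=> q x y k z z'; rewrite dotDr dotZr; have /= -> := F3 q x y k z z'; ring.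
- by move=> q x y z; rewrite Bskew Fskew opprB opprK addrC.
- by move=> r q x y z ur; rewrite Finv // Bequiv // (cact_dot _ _ ur).
- by rewrite f1 f2 f3 !opprK !subrr.
- by rewrite f4 f5 f6 f7 !opprK !subrr.
Qed.

End Classification.

(** * The tensors of the theorem *)

Section InvariantTensor.
Context {R : realType}.
Implicit Types (u v w : C3 R) (p : @S5 R).

(** The tensor that represents [invform], with the terms arranged as in the theorem; the b-term is
    nabla^g psi in the form given by [cov_psiE]. *)
Definition invtensor (a b c d e f h : R) p u v : C3 R :=
  a *: (Phi p u v *: xi p + eta_form p v *: psi p u)
  + b *: (dot u v *: xi p - eta_form p v *: u)
  + c *: (eta_form p v *: psi p (hpsi p u) + Phi p (hpsi p u) v *: xi p)
  + d *: (- (eta_form p v *: hpsi p u) + dot (hpsi p u) v *: xi p)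
  + e *: (eta_form p u *: psi p (hpsi p v))
  - f *: (eta_form p u *: hpsi p v)
  + h *: (eta_form p u *: psi p v).

Lemma xi_dot p w : dot (xi p) w = eta_form p w.
Proof. by rewrite /xi /eta_form dotNl mulI_dot opprK dotC. Qed.

Lemma xi_tangent p : tangent p (xi p).
Proof. by rewrite /tangent /xi dotNl mulI_val_orth oppr0. Qed.

Lemma psi_dot p u w : tangent p w -> dot (psi p u) w = dot (mulI u) w.
Proof. by move=> tw; rewrite /psi dotBl dotZl (dotC (val p)) tw mulr0 subr0. Qed.

Lemma Phi_dot p u v : tangent p u -> Phi p u v = - dot (mulI u) v.
Proof. by move=> tu; rewrite /Phi dotC psi_dot // mulI_dot dotC. Qed.

Lemma invtensor_dot a b c d e f h p u v w : tangent p u -> tangent p v -> tangent p w ->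
  dot (invtensor a b c d e f h p u v) w = invform a b c d e f h p u v w.
Proof.
move=> tu tv tw; rewrite /invtensor /invform (Phi_dot v tu) (Phi_dot v (hpsi_val p u)).
move: (xi_dot p w) (psi_dot u tw) (psi_dot (hpsi p u) tw).
move: (psi_dot (hpsi p v) tw) (psi_dot v tw).
move: (xi p) (psi p) (eta_form p) (hpsi p) (@mulI R) => x P E H I h4 h5 h1 h2 h3.
by rewrite !(dotDl, dotNl, dotZl) h1 h2 h3 h4 h5; ring.
Qed.

Lemma invtensor_tangent a b c d e f h p u v : tangent p u ->
  tangent p (invtensor a b c d e f h p u v).
Proof.
rewrite /tangent /invtensor; move: (psi_val_orth p) (hpsi_val p) (xi_tangent p).
rewrite /tangent; move: (xi p) (psi p) (eta_form p) (hpsi p) (Phi p).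
move=> x P E H Ph hP hH hx hu.
rewrite !(dotDl, dotNl, dotZl) !hP !hH hx hu; ring.
Qed.

Lemma tangent_eq p u v : tangent p u -> tangent p v ->
  (forall w, tangent p w -> dot u w = dot v w) -> u = v.
Proof.
move=> tu tv h; apply/eqP; rewrite -subr_eq0; apply/eqP/dot_eq0.
rewrite dotBl h ?subrr //; by rewrite /tangent dotBl tu tv subrr.
Qed.

(** For these coefficients the form is a combination of wedge products of eta with the 2-forms <i u,
    v>, <i hat psi u, v> and <hat psi u, v>. *)
Lemma invform_totally_skew a c d p u v w :
  invform a 0 c d (- c) (- d) (- a) p u v w =
  - invform a 0 c d (- c) (- d) (- a) p v u w.
Proof.
move: (dot_hpsi_skew p) (mulI_hpsi_skew p) (@mulI_dot_skew R); rewrite /invform.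
move: (eta_form p) (@mulI R) (hpsi p) => E I H hH hIH hI.
rewrite (hH v u) (hIH v u) (hI v u); ring.
Qed.

(** The hypothesis is that the torsion form alternates in its last two arguments. As F is skew there
    itself, F becomes skew under exchange of the outer arguments ([K]), hence of the first two
    ([L]); comparing coordinates gives the relations. *)
Lemma invform_totally_skew_coef a b c d e f h
    (F := invform a b c d e f h base_point) (E := @real_basis R) :
  (forall i j k, (0 < i < 6)%N -> (0 < j < 6)%N -> (0 < k < 6)%N ->
     F (E i) (E j) (E k) - F (E j) (E i) (E k)
     = - (F (E i) (E k) (E j) - F (E k) (E i) (E j))) ->
  [/\ b = 0, e = - c, f = - d & h = - a].
Proof.
move=> H; have sk := invform_skew a b c d e f h base_point.
have [[]] := invform_base a b c d e f h; move: H; rewrite {}/F {}/E.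
move: sk; move: (invform _ _ _ _ _ _ _ _) (@real_basis R) => F E sk H.
move=> f1 f2 f3 [f4 f5 f6 f7].
have K i j k : (0 < i < 6)%N -> (0 < j < 6)%N -> (0 < k < 6)%N ->
    F (E j) (E i) (E k) = - F (E k) (E i) (E j).
  by move=> hi hj hk; have := H i j k hi hj hk; rewrite (sk (E i) (E k)); lra.
have L k : (0 < k < 6)%N -> F (E 1%N) (E 2%N) (E k) = - F (E 2%N) (E 1%N) (E k).
  by move=> hk; rewrite (K 2%N 1%N k) // sk opprK (K 1%N k 2%N).
have := L 3%N isT; have := L 4%N isT; have := L 5%N isT.
have := K 1%N 2%N 2%N isT isT isT.
rewrite f1 f2 f3 f4 f5 f6 f7; move=> {K L f1 f2 f3 f4 f5 f6 f7 H sk} *; split; lra.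
Qed.

End InvariantTensor.

(** * The two normal forms: general and with skew torsion *)

Theorem theorem6p8 (R : realType) (nablag nabla : @connection R)
    (hg : levi_civita nablag) (hnabla : affine_connection nabla)
    (hmetric : metric nabla) (hinv : SU3_invariant nabla) :
  (exists (q1 q2 q3 : R[i]) (t : R),
    forall X Y : field, vector_field X -> vector_field Y ->
    forall p : S5,
      nabla X Y p =
        nablag X Y p
        + (complex.Re q1 - 1) *:
            (Phi p (X p) (Y p) *: xi p + eta_form p (Y p) *: psi p (X p))
        + complex.Im q1 *: cov_psi nablag X Y p
        + complex.Re q2 *:
            (eta_form p (Y p) *: psi p (hpsi p (X p))
             + Phi p (hpsi p (X p)) (Y p) *: xi p)
        + complex.Im q2 *:
            (- (eta_form p (Y p) *: hpsi p (X p))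
             + dot (hpsi p (X p)) (Y p) *: xi p)
        + complex.Re q3 *: (eta_form p (X p) *: psi p (hpsi p (Y p)))
        - complex.Im q3 *: (eta_form p (X p) *: hpsi p (Y p))
        + (t + 2^-1) *: (eta_form p (X p) *: psi p (Y p)))
  /\
  (totally_skew_torsion nabla <->
   exists (r : R) (q : R[i]),
    forall X Y : field, vector_field X -> vector_field Y ->
    forall p : S5,
      nabla X Y p =
        nablag X Y p
        + r *: (Phi p (X p) (Y p) *: xi p - eta_form p (X p) *: psi p (Y p)
                + eta_form p (Y p) *: psi p (X p))
        + complex.Re q *:
            (eta_form p (Y p) *: psi p (hpsi p (X p))
             - eta_form p (X p) *: psi p (hpsi p (Y p))
             + Phi p (hpsi p (X p)) (Y p) *: xi p)
        + complex.Im q *: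
            (eta_form p (X p) *: hpsi p (Y p) - eta_form p (Y p) *: hpsi p (X p)
             + dot (hpsi p (X p)) (Y p) *: xi p)).
Proof.
have [B [BE Blin Btan Bskew Bequiv]] := difference_tensor hg hnabla hmetric hinv.
have [a [b [c [d [e [f [h Bform]]]]]]] := invariant_tensorE Blin Bskew Bequiv.
have BI p u v : tangent p u -> tangent p v -> B p u v = invtensor a b c d e f h p u v.
  move=> tu tv; apply: tangent_eq => [||w tw]; [exact: Btan|exact: invtensor_tangent|].
  by rewrite invtensor_dot // Bform.
have tX (X : @field R) p : vector_field X -> tangent p (X p) by case.
have [[gv _ _ _ _] _ tg] := hg; have [nv _ _ _ _] := hnabla.
have torE (X Y : @field R) p : vector_field X -> vector_field Y ->
    torsion nabla X Y p = B p (X p) (Y p) - B p (Y p) (X p).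
  move=> vX vY; have := tg X Y vX vY p.
  rewrite /torsion (BE _ _ vX vY) (BE _ _ vY vX).
  move: (nablag X Y p) (nablag Y X p) (bracket X Y p) (B p _ _) (B p _ _).
  move=> x y z x' y' e0.
  by rewrite -[RHS]add0r -e0; apply/matrixP => i j; rewrite !mxE; ring.
(* The second formula is the first one subject to the four linear relations. *)
have skew_tensor (r c' d' : R) p u v :
    r *: (Phi p u v *: xi p - eta_form p u *: psi p v + eta_form p v *: psi p u)
    + c' *: (eta_form p v *: psi p (hpsi p u) - eta_form p u *: psi p (hpsi p v)
             + Phi p (hpsi p u) v *: xi p)
    + d' *: (eta_form p u *: hpsi p v - eta_form p v *: hpsi p u
             + dot (hpsi p u) v *: xi p)
    = invtensor r 0 c' d' (- c') (- d') (- r) p u v.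
  rewrite /invtensor; move: (xi p) (psi p) (eta_form p) (hpsi p) (Phi p) => x P E H Ph.
  by apply/matrixP => i j; rewrite !mxE; ring.
split.
  exists (Complex (a + 1) b), (Complex c d), (Complex e f), (h - 2^-1) => X Y vX vY p.
  rewrite (BE _ _ vX vY) BI; [|exact: tX|exact: tX].
  rewrite (cov_psiE hg vX vY) /= addrK subrK /invtensor.
  move: (nablag X Y p) (xi p) (psi p) (eta_form p) (hpsi p) (Phi p) => n x P E H Ph.
  by rewrite !addrA.
split=> [[_ _ _ _ skew3]|[r [q HB]]].
  have [b0 e0 f0 h0] : [/\ b = 0, e = - c, f = - d & h = - a].
    apply: invform_totally_skew_coef => i j k hi hj hk.
    (* The skewness of the torsion is tested on projected constant fields, whose values at the base
       point are the tangent basis vectors themselves. *)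
    have tE n : (0 < n < 6)%N -> tangent (@base_point R) (real_basis n).
      by case: n => [|n] // /andP[_ hn]; rewrite /tangent /= basis_dot.
    have pE n : (0 < n < 6)%N ->
        proj_field (real_basis n) (@base_point R) = real_basis n.
      by move=> hn; apply: proj_field_tangent; exact: tE.
    have := skew3 _ _ _ (@proj_fieldP R (real_basis i))
      (@proj_fieldP R (real_basis j)) (@proj_fieldP R (real_basis k)) base_point.
    rewrite /g !torE; try exact: proj_fieldP.
    rewrite !pE // !dotBl !Bform //; exact: tE.
  exists a, (Complex c d) => X Y vX vY p.
  rewrite (BE _ _ vX vY) BI; [|exact: tX|exact: tX].
  rewrite b0 e0 f0 h0 -skew_tensor /=.
  move: (nablag X Y p) (xi p) (psi p) (eta_form p) (hpsi p) (Phi p) => n x P E H Ph.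
  by rewrite !addrA.
have Bskew3 p u v w : tangent p u -> tangent p v -> tangent p w ->
    dot (B p u v) w = - dot (B p v u) w.
  move=> tu tv tw.
  (* Projected constant fields through x and y turn the assumed identity between fields into one
     between tensors at p. *)
  have Br x y : tangent p x -> tangent p y ->
      B p x y = invtensor r 0 (complex.Re q) (complex.Im q)
        (- complex.Re q) (- complex.Im q) (- r) p x y.
    move=> tx ty; have := HB _ _ (@proj_fieldP R x) (@proj_fieldP R y) p.
    rewrite (BE _ _ (@proj_fieldP R x) (@proj_fieldP R y)) !proj_field_tangent //.
    rewrite -skew_tensor; move: (nablag _ _ p) (B p x y).
    move: (xi p) (psi p) (eta_form p) (hpsi p) (Phi p) => ? ? ? ? ? n m.
    by rewrite -!(addrA n) => /addrI.
  rewrite (Br _ _ tu tv) (Br _ _ tv tu).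
  apply: etrans (invtensor_dot _ _ _ _ _ _ _ tu tv tw) _.
  apply: etrans (invform_totally_skew _ _ _ _ _ _ _) _.
  exact: congr1 (esym (invtensor_dot _ _ _ _ _ _ _ tv tu tw)).
split.
- move=> X Y Z vX vY [_ sZ]; apply: smooth_dot => //.
  (* As nabla^g is torsion-free, the bracket is a difference of values of nabla^g; smoothness then
     follows from that of the two connections. *)
  have -> : torsion nabla X Y =
      fun p => (nabla X Y p - nabla Y X p) + - (nablag X Y p - nablag Y X p).
    apply/funext => p; rewrite torE // (BE _ _ vX vY) (BE _ _ vY vX).
    by apply/matrixP => i j; rewrite !mxE; ring.
  have [_ sXY] := nv _ _ vX vY; have [_ sYX] := nv _ _ vY vX.
  have [_ gXY] := gv _ _ vX vY; have [_ gYX] := gv _ _ vY vX.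
  apply: smoothD; first by apply: smoothD => //; exact: smoothN.
  by apply: smoothN; apply: smoothD => //; exact: smoothN.
- move=> X X' Y Z vX vX' vY vZ p; rewrite /g !torE //; last exact: vector_fieldD.
  have [l1 l2] := Blin p.
  have := l1 (Y p) 1 (X p) (X' p); have := l2 (Y p) 1 (X p) (X' p).
  rewrite !scale1r => -> ->.
  rewrite !(dotDl, dotNl); ring.
- move=> k X Y Z sk vX vY vZ p; rewrite /g !torE //; last exact: vector_fieldZ.
  have [l1 l2] := Blin p.
  have B0 x : B p 0 x = 0.
    by have := l1 x (-1) 0 0; rewrite scaler0 addr0 scaleN1r addNr.
  have B0' x : B p x 0 = 0.
    by have := l2 x (-1) 0 0; rewrite scaler0 addr0 scaleN1r addNr.
  have := l1 (Y p) (k p) (X p) 0; have := l2 (Y p) (k p) (X p) 0.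
  rewrite B0 B0' !addr0 => -> ->; rewrite !(dotDl, dotNl, dotZl); ring.
- by move=> X Y Z vX vY vZ p; rewrite /g !torE // -dotNl opprB.
- move=> X Y Z vX vY vZ p; rewrite /g !torE // !dotBl.
  have [x [y z]] := (tX _ p vX, (tX _ p vY, tX _ p vZ)).
  (* Exchanging the first two arguments makes the torsion form twice <B(X, Y), Z>, which is skew in
     Y and Z. *)
  rewrite (Bskew3 p (Y p) (X p) (Z p)) // (Bskew3 p (Z p) (X p) (Y p)) //.
  rewrite (Bskew p (X p) (Z p)).
  ring.
Qed.
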